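(* There exist positive constants $C_0\le C_1$ and $C_2$ depending only on $\gamma$ and $L_{H,2}$ such that the following holds. If $$C_0\max_j h_{T^{n,i}_j}\le\varepsilon^n_i\le C_1\max_j h_{T^{n,i}_j}\ \ (i=1,\dots,M),\qquad \tau^n\le C_2\min_{i,j}|E^{n,i}_j|,$$ and $u_h^n,v_h^n\in V_h^n$ satisfy $u_h^n\le v_h^n$ on $\Gamma_h(t^n)$, then $S_h^n(u_h^n)\le S_h^n(v_h^n)$ on $\Gamma_h(t^{n+1})$.
   Context: Evolving surface (fixed throughout; constants may depend on it). $\Gamma_0\subset\mathbb{R}^3$ is a closed (compact, without boundary), connected, oriented, smooth hypersurface, $T>0$, and $\Phi:\Gamma_0\times[0,T]\to\mathbb{R}^3$ is a smooth flow map such that $\Phi(\cdot,t)$ is a diffeomorphism of $\Gamma_0$ onto a hypersurface $\Gamma(t)$, with $\Phi(X,0)=X$ and $\partial_t\Phi(X,t)=v_\Gamma(\Phi(X,t),t)$, $v_\Gamma\in C^1(\overline{S_T})$, where $\overline{S_T}=\bigcup_{t\in[0,T]}\Gamma(t)\times\{t\}$. $d(\cdot,t)$ is the signed distance function to $\Gamma(t)$ increasing in the direction of the unit outward normal $\nu(\cdot,t)$, and $\pi(x,t)\in\Gamma(t)$ is the unique point with $x=\pi(x,t)+d(x,t)\nu(\pi(x,t),t)$, for $x$ in a suitable neighbourhood $N(t)$ of $\Gamma(t)$. Hamiltonian. $H:\overline{S_T}\times\mathbb{R}^3\to\mathbb{R}$ satisfies, with positive constants $L_{H,1},L_{H,2}$,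 for all $(x,t),(y,s)\in\overline{S_T}$, $p,q\in\mathbb{R}^3$: $|H(x,t,p)-H(y,s,p)|\le L_{H,1}(|x-y|+|t-s|)(1+|p|)$ and $|H(x,t,p)-H(x,t,q)|\le L_{H,2}|p-q|$. Triangulations. For $0<h<h_*$ let $\mathcal{T}_h(t)$ be a triangulation with polyhedral surface $\Gamma_h(t)=\bigcup_{K(t)\in\mathcal{T}_h(t)}K(t)$ (flat triangles), $h=\max_{t\in[0,T]}\max_{K(t)}h_{K(t)}$, $h_{K(t)}=\operatorname{diam}K(t)$. The $M$ vertices $x_i(t)=\Phi(x_i^0,t)\in\Gamma(t)$ are moved by the flow map, with connectivity fixed in time. $h_*$ is small enough that $\Gamma_h(t)\subset N(t)$, and $\pi_h(\cdot,t)=\pi(\cdot,t)|_{\Gamma_h(t)}$ is assumed to be a homeomorphism onto $\Gamma(t)$. Regularity: there is $\gamma>0$ with $h_{K(t)}\le\gamma\rho_{K(t)}$ for all $t\in[0,T]$ and $K(t)\in\mathcal{T}_h(t)$ (and all $h$), where $\rho_{K(t)}$ is the radius of the largest circle contained in $K(t)$. $V_h(t)$ is the space of continuous functions on $\Gamma_h(t)$, affine on each triangle, with nodal basis $\chi_i(\cdot,t)$, $\chi_i(x_j(t),t)=\delta_{ij}$. Scheme. Let $0=t^0<t^1<\dots<t^N=T$, $\tau^n=t^{n+1}-t^n$, $x_i^n=x_i(t^n)$, $V_h^n=V_h(t^n)$. Let $\Upsilon_i$ be the number of triangles with common vertex $i$, and let $i_1,\dots,i_{\Upsilon_i}$ be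 the other vertices of these triangles, enumerated cyclically in clockwise direction (indices $j$ cyclic modulo $\Upsilon_i$). $T_j^{n,i}\in\mathcal{T}_h(t^n)$ is the triangle with vertices $i,i_j,i_{j+1}$, $h_{T_j^{n,i}}$ its diameter, and $E_j^{n,i}$ (length $|E_j^{n,i}|$) the edge joining $i$ and $i_j$. Let $d_j^{n,i}$ be the distance from vertex $i$ to the contact point on $E_j^{n,i}$ of the inscribed circle of $T_j^{n,i}$ and $d^{n,i}=\min_j d_j^{n,i}$. The volume $V^{n,i}\subset\Gamma_h(t^n)$ is the polygonal region around $i$ bounded by line segments perpendicular to the edges $E_j^{n,i}$ at distance $d^{n,i}$ from vertex $i$; i.e. $V^{n,i}\cap T_j^{n,i}$ is the quadrilateral in $T_j^{n,i}$ whose vertices are $x_i^n$, the points of $E_j^{n,i}$ and $E_{j+1}^{n,i}$ at distance $d^{n,i}$ from $x_i^n$, and the intersection of the perpendiculars to these edges (in the plane of $T_j^{n,i}$) at those points. $h_{j,L}^{n,i}$ and $h_{j,R}^{n,i}$ are the lengths of the parts of the boundary of $V^{n,i}$ perpendicular to $E_j^{n,i}$ lying in $T_{j-1}^{n,i}$ and $T_j^{n,i}$, respectively. $|\cdot|$ of a two-dimensional set is its area, $\varepsilon_i^n>0$ are parameters, and $\nabla_{\Gamma_h}u_h|_{T}$ is the (constant) tangential gradient of $u_h$ on the flat triangle $T$. For $u_h^n=\sum_iu_i^n\chi_i(\cdot,t^n)\in V_h^n$ and $n\in\{0,\dots,N-1\}$ define $S_h^n(u_h^n)=\sum_{i=1}^M[S_h^n(u_h^n)]_i\,\chi_i(\cdot,t^{n+1})\in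 V_h^{n+1}$ with $$[S_h^n(u_h^n)]_i=u_i^n-\tau^n\Bigl\{\sum_{j=1}^{\Upsilon_i}\tfrac{|V^{n,i}\cap T_j^{n,i}|}{|V^{n,i}|}H\bigl(x_i^n,t^n,\nabla_{\Gamma_h}u_h^n|_{T_j^{n,i}}\bigr)-\tfrac{\varepsilon_i^n}{|V^{n,i}|}\sum_{j=1}^{\Upsilon_i}\tfrac{u_{i_j}^n-u_i^n}{|E_j^{n,i}|}(h_{j,L}^{n,i}+h_{j,R}^{n,i})\Bigr\}.$$ *)

(* Defs.v *)
From HB Require Import structures.
From mathcomp Require Import all_boot all_order all_algebra.
From mathcomp Require Import all_classical all_reals all_analysis.

Set Implicit Arguments.
Unset Strict Implicit.
Unset Printing Implicit Defensive.

Import Order.TTheory GRing.Theory Num.Theory.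
Import numFieldNormedType.Exports.

Local Open Scope classical_set_scope.
Local Open Scope ring_scope.

(* The library norm of 'rV[R]_n is the sup norm (same topology); lengths and
   distances below are Euclidean and use [dotp] and [enorm]. *)
Notation E3 R := 'rV[R]_3.
Notation E2 R := 'rV[R]_2.

Section Euclidean.
Variable R : realType.
Implicit Types (x y z a b c n : E3 R) (A : set (E3 R)).

Definition dotp x y : R := \sum_(k < 3) x 0 k * y 0 k.
Definition enorm x : R := Num.sqrt (dotp x x).
(* index arithmetic is modulo 3 *)
Definition cross x y : E3 R :=
  \row_(k < 3) (x 0 (k + 1) * y 0 (k + 2%:R) - x 0 (k + 2%:R) * y 0 (k + 1)).

Definition diam A : R := sup [set r | exists x y, [/\ A x, A y & r = enorm (x - y)]].
Definition edist A x : R := inf [set enorm (x - y) | y in A].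

(* The region enclosed by a closed surface A. *)
Definition inside A : set (E3 R) :=
  [set x | ~ A x /\ bounded_set (connected_component (~` A) x)].
Definition sdist A x : R := if `[< inside A x >] then - edist A x else edist A x.
Definition points_outward A x n : Prop :=
  exists2 e : R, 0 < e & forall s, 0 < s < e ->
    inside A (x - s *: n) /\ ~ (A `|` inside A) (x + s *: n).

Definition tri_area a b c : R := enorm (cross (b - a) (c - a)) / 2%:R.
(* area of a convex quadrilateral with vertices a, b, c, e in cyclic order *)
Definition quad_area a b c e : R := tri_area a b c + tri_area a c e.

End Euclidean.

Section Smoothness.
Variable R : realType.

Fixpoint Ck (k : nat) (V W : normedModType R) (U : set V) (f : V -> W) : Prop :=
  (forall x, U x -> {for x, continuous f}) /\
  match k with
  | 0 => True
  | k'.+1 => forall v : V, (forall x, U x -> derivable f x v) /\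
                           Ck k' U (fun x => 'D_v f x)
  end.

Definition smooth (V W : normedModType R) (U : set V) (f : V -> W) : Prop :=
  forall k, Ck k U f.

(* Regularity on a set A that need not be open: f is locally the restriction to
   A of a regular map defined on an open set. *)
Definition Ck_on (k : nat) (V W : normedModType R) (A : set V) (f : V -> W) :=
  forall a, A a -> exists (U : set V) (F : V -> W),
    [/\ open U, U a, Ck k U F & forall x, A x -> U x -> F x = f x].
Definition smooth_on (V W : normedModType R) (A : set V) (f : V -> W) :=
  forall a, A a -> exists (U : set V) (F : V -> W),
    [/\ open U, U a, smooth U F & forall x, A x -> U x -> F x = f x].

Definition homeo_onto (V W : topologicalType) (A : set V) (B : set W) (f : V -> W) :=
  [/\ {within A, continuous f}, set_bij A B f &
      exists g : W -> V, {within B, continuous g} /\ forall x, A x -> g (f x) = x].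

(* Regular embedded surface: around each point, the image of an open subset of
   the plane by a smooth immersion that is a homeomorphism onto its image. *)
Definition regular_surface (A : set (E3 R)) : Prop :=
  forall p, A p -> exists (U : set (E3 R)) (W : set (E2 R)) (phi : E2 R -> E3 R),
    [/\ open U, U p & open W] /\
    [/\ smooth W phi, homeo_onto W (A `&` U) phi &
        forall a w, W a -> w != 0 -> 'D_w phi a != 0].

Definition closed_hypersurface (A : set (E3 R)) : Prop :=
  [/\ A !=set0, compact A, connected A & regular_surface A].

(* n is orthogonal to the velocity of every differentiable curve in A through x *)
Definition normal_at (A : set (E3 R)) (x n : E3 R) : Prop :=
  forall c : R -> E3 R, c 0 = x -> (\forall s \near (0 : R), A (c s)) ->
    derivable c 0 1 -> dotp ('D_1 c 0) n = 0.

End Smoothness.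

Section EvolvingSurface.
Variable R : realType.

Record evolving_surface := EvolvingSurface {
  Gamma0 : set (E3 R);
  Tend : R;
  Phi : E3 R -> R -> E3 R;
  vel : E3 R -> R -> E3 R;
  nu : R -> E3 R -> E3 R;
  Gamma := fun t : R => [set Phi X t | X in Gamma0];
  spacetime := [set z : E3 R * R | 0 <= z.2 <= Tend /\ Gamma z.2 z.1];
  Tend_gt0 : 0 < Tend;
  Gamma0_surface : closed_hypersurface Gamma0;
  Phi_smooth : smooth_on [set z : E3 R * R | Gamma0 z.1 /\ 0 <= z.2 <= Tend]
                         (fun z : E3 R * R => Phi z.1 z.2);
  Phi_init : forall X, Gamma0 X -> Phi X 0 = X;
  Gamma_surface : forall t, 0 <= t <= Tend -> closed_hypersurface (Gamma t);
  Phi_diffeo : forall t, 0 <= t <= Tend -> exists Psi : E3 R -> E3 R,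
    smooth_on (Gamma t) Psi /\ forall X, Gamma0 X -> Psi (Phi X t) = X;
  (* one-sided time derivative at the end points 0 and Tend *)
  Phi_flow : forall X t, Gamma0 X -> 0 <= t <= Tend ->
    (fun s : R => (s - t)^-1 *: (Phi X s - Phi X t))
      @ within [set s | 0 <= s <= Tend] t^' --> vel (Phi X t) t;
  vel_C1 : Ck_on 1 spacetime (fun z : E3 R * R => vel z.1 z.2);
  nu_normal : forall t x, 0 <= t <= Tend -> Gamma t x ->
    [/\ enorm (nu t x) = 1, normal_at (Gamma t) x (nu t x)
      & points_outward (Gamma t) x (nu t x)]
}.

Variable S : evolving_surface.

Definition is_proj (t : R) (x y : E3 R) : Prop :=
  Gamma S t y /\ x = y + sdist (Gamma S t) x *: nu S t y.

Definition surface_nbhd (N : R -> set (E3 R)) : Prop :=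
  forall t, 0 <= t <= Tend S ->
    [/\ open (N t), Gamma S t `<=` N t
      & forall x, N t x -> exists! y, is_proj t x y].

(* closest-point projection; only meaningful on a neighbourhood as above *)
Definition proj (t : R) (x : E3 R) : E3 R := xget x [set y | is_proj t x y].

Definition hamiltonian (H : E3 R -> R -> E3 R -> R) (L1 L2 : R) : Prop :=
  (forall x t y s p, spacetime S (x, t) -> spacetime S (y, s) ->
     `|H x t p - H y s p| <= L1 * (enorm (x - y) + `|t - s|) * (1 + enorm p)) /\
  (forall x t p q, spacetime S (x, t) ->
     `|H x t p - H x t q| <= L2 * enorm (p - q)).

End EvolvingSurface.

Section Triangles.
Variables (R : realType) (M : nat) (x : 'I_M -> E3 R).
Implicit Types (K : {set 'I_M}) (i a b : 'I_M).

Definition hull K : set (E3 R) := [set y | exists w : 'I_M -> R,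
  [/\ forall k, 0 <= w k, \sum_(k in K) w k = 1 & y = \sum_(k in K) w k *: x k]].
Definition aff K : set (E3 R) := [set y | exists w : 'I_M -> R,
  \sum_(k in K) w k = 1 /\ y = \sum_(k in K) w k *: x k].
Definition aff_independent K : Prop := forall w : 'I_M -> R,
  \sum_(k in K) w k = 0 -> \sum_(k in K) w k *: x k = 0 ->
  forall k, k \in K -> w k = 0.

(* radius of the largest disc of the plane of K that is contained in K *)
Definition inradius K : R := sup [set r | 0 <= r /\ exists2 c, hull K c &
  forall y, aff K y -> enorm (y - c) <= r -> hull K y].

(* the circle of centre c and radius r touches the side [x a, x b] at p *)
Definition touches (c : E3 R) (r : R) a b (p : E3 R) : Prop :=
  [/\ hull [set a; b] p, enorm (p - c) = r & dotp (p - c) (x b - x a) = 0].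

(* contact point on [x i, x a] of the inscribed circle of the triangle i, a, b *)
Definition contact i a b : E3 R := xget (x i) [set p | exists c r q q',
  [/\ hull [set i; a; b] c, touches c r i a p, touches c r a b q
    & touches c r b i q']].

Definition edge_len i a : R := enorm (x a - x i).

(* point of the edge from x i to x a at distance d from x i *)
Definition edge_point (d : R) i a : E3 R := x i + (d / edge_len i a) *: (x a - x i).

(* intersection, in the plane of the triangle i, a, b, of the perpendiculars to
   the edges from x i to x a and to x b at distance d from x i *)
Definition corner (d : R) i a b : E3 R := xget (x i) [set s |
  [/\ aff [set i; a; b] s, dotp (s - edge_point d i a) (x a - x i) = 0
    & dotp (s - edge_point d i b) (x b - x i) = 0]].

(* gradient of the restriction of u to the flat triangle K, where i is in K *)
Definition tgrad (u : E3 R -> R) i K : E3 R := xget 0 [set g |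
  aff K (x i + g) /\
  forall y z, hull K y -> hull K z -> u z - u y = dotp g (z - y)].

End Triangles.

Section Meshes.
Variables (R : realType) (M : nat).

(* Connectivity of a triangulated closed surface with vertex set 'I_M; the
   neighbours of vertex i are enumerated by nbr i, cyclically through ordS. *)
Definition degree (tris : {set {set 'I_M}}) (i : 'I_M) : nat :=
  #|[set K in tris | i \in K]|.

Record mesh := Mesh {
  x0 : 'I_M -> E3 R;
  tris : {set {set 'I_M}};
  nbr : forall i, 'I_(degree tris i) -> 'I_M
}.

Variables (S : evolving_surface R) (m : mesh).
Implicit Types (t : R) (i : 'I_M).

Definition Ups i : nat := degree (tris m) i.
Definition vtx t i : E3 R := Phi S (x0 m i) t.
Definition nb i (j : 'I_(Ups i)) : 'I_M := nbr (m := m) j.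
Definition star_tri i (j : 'I_(Ups i)) : {set 'I_M} :=
  [set i; nb j; nb (ordS j)].

Definition Gammah t : set (E3 R) :=
  [set y | exists2 K, K \in tris m & hull (vtx t) K y].

Definition mesh_size : R := sup [set r | exists t K,
  [/\ 0 <= t <= Tend S, K \in tris m & r = diam (hull (vtx t) K)]].

Definition triangulation : Prop :=
  [/\ forall i, Gamma0 S (x0 m i),
      forall K, K \in tris m -> #|K| = 3%N,
      forall i, exists2 K, K \in tris m & i \in K,
      forall t K, 0 <= t <= Tend S -> K \in tris m -> aff_independent (vtx t) K
    & forall t K K', 0 <= t <= Tend S -> K \in tris m -> K' \in tris m ->
        hull (vtx t) K `&` hull (vtx t) K' = hull (vtx t) (K :&: K')%SET].

(* Clockwise as seen from outside Gammah: the outward side of each triangle of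
   the star is opposite to the cross product of its consecutive edges. *)
Definition clockwise_stars : Prop := forall i,
  [/\ injective (@nb i),
      [set star_tri j | j : 'I_(Ups i)]%SET = [set K in tris m | i \in K]%SET
    & forall t j, 0 <= t <= Tend S ->
        let a := vtx t (nb (j : 'I_(Ups i))) in
        let b := vtx t (nb (ordS j)) in
        points_outward (Gammah t) (3%:R^-1 *: (vtx t i + a + b))
          (- cross (a - vtx t i) (b - vtx t i))].

Definition regular_mesh (gamma : R) : Prop :=
  forall t K, 0 <= t <= Tend S -> K \in tris m ->
    diam (hull (vtx t) K) <= gamma * inradius (vtx t) K.

Definition admissible_mesh (gamma : R) (N : R -> set (E3 R)) : Prop :=
  [/\ triangulation, clockwise_stars, regular_mesh gamma
    & forall t, 0 <= t <= Tend S ->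
        Gammah t `<=` N t /\ homeo_onto (Gammah t) (Gamma S t) (proj S t)].

Definition in_Vh t (u : E3 R -> R) : Prop :=
  {within Gammah t, continuous u} /\
  forall K y z (s : R), K \in tris m -> hull (vtx t) K y -> hull (vtx t) K z ->
    0 <= s <= 1 -> u (s *: y + (1 - s) *: z) = s * u y + (1 - s) * u z.

Definition nodal_basis (chi : 'I_M -> R -> E3 R -> R) : Prop :=
  forall i t, 0 <= t <= Tend S ->
    in_Vh t (chi i t) /\ forall j, chi i t (vtx t j) = (i == j)%:R.

Section Volumes.
Variables (t : R) (i : 'I_M).
Implicit Types j : 'I_(Ups i).

Definition tri_diam j : R := diam (hull (vtx t) (star_tri j)).
Definition nb_len j : R := edge_len (vtx t) i (nb j).

Definition contact_dist j : R :=
  enorm (contact (vtx t) i (nb j) (nb (ordS j)) - vtx t i).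
(* minimum over the finitely many j *)
Definition vol_dist : R := inf (range contact_dist).

Definition vol_foot j : E3 R := edge_point (vtx t) vol_dist i (nb j).
Definition vol_corner j : E3 R := corner (vtx t) vol_dist i (nb j) (nb (ordS j)).

(* area of the part of the volume around i that lies in the j-th triangle *)
Definition vol_part j : R :=
  quad_area (vtx t i) (vol_foot j) (vol_corner j) (vol_foot (ordS j)).
Definition vol : R := \sum_(j < Ups i) vol_part j.

Definition hL j : R := enorm (vol_corner (ord_pred j) - vol_foot j).
Definition hR j : R := enorm (vol_corner j - vol_foot j).

End Volumes.

Definition max_tri_diam t i : R := sup (range (@tri_diam t i)).
Definition min_nb_len t : R :=
  inf [set r | exists i (j : 'I_(Ups i)), r = nb_len t j].

Definition scheme_coef (H : E3 R -> R -> E3 R -> R) t (tau eps : R)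
    (u : E3 R -> R) i : R :=
  u (vtx t i) - tau *
    (\sum_(j < Ups i) vol_part t j / vol t i *
         H (vtx t i) t (tgrad (vtx t) u i (star_tri j))
     - eps / vol t i *
       \sum_(j < Ups i) (u (vtx t (nb j)) - u (vtx t i)) / nb_len t j *
         (hL t j + hR t j)).

Definition scheme (chi : 'I_M -> R -> E3 R -> R) (H : E3 R -> R -> E3 R -> R)
    (tk : nat -> R) (eps : nat -> 'I_M -> R) (n : nat) (u : E3 R -> R)
    (y : E3 R) : R :=
  \sum_(i < M) scheme_coef H (tk n) (tk n.+1 - tk n) (eps n i) u i *
    chi i (tk n.+1) y.

End Meshes.

Definition time_grid (R : realType) (T : R) (N : nat) (tk : nat -> R) : Prop :=
  [/\ tk 0%N = 0, tk N = T & forall n, (n < N)%N -> tk n < tk n.+1].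

(* Main.v *)
(* After subtracting the two values of the scheme, the Hamiltonian terms are
   bounded by the gradient of [w = v - u >= 0], and on a triangle of diameter [h]
   one has [2 h |grad w| <= gamma (|w_a - w_i| + |w_b - w_i|)].  Because every
   piece of the volume has area [d hR], where [d = d^{n,i}], the nodal values of
   [w] at the neighbours are absorbed by the artificial diffusion as soon as
   [eps >= (L2 gamma / 2) max h].  The coefficient of [w_i] is nonnegative for
   [tau <= C2 min |E|] provided that [max h <= D d] in each star.

   This last comparison is not a matter of a single triangle: it needs a bound
   on the ratio of the edges meeting at one vertex, whatever their number.  At
   time [0] the surface satisfies [|(z - y).nu(y)| <= K |z - y|^2].  Small
   triangles are therefore almost tangential, and two of them with a common
   vertex and nearly equal bisectors would meet the same short normal segment,
   against the injectivity of the projection.  Hence each star has boundedly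
   many small triangles; consecutive edges of the star are comparable, so all of
   them are.  At later times the edge lengths are comparable with the initial
   ones by Gronwall's inequality, the velocity being Lipschitz. *)

Require Import Defs.
From HB Require Import structures.
From mathcomp Require Import all_boot all_order all_algebra.
From mathcomp Require Import all_classical all_reals all_analysis.
From mathcomp Require Import zify ring lra.
Import Order.TTheory GRing.Theory Num.Theory.
Import numFieldNormedType.Exports.
Local Open Scope classical_set_scope.
Local Open Scope ring_scope.
Set Implicit Arguments.
Unset Strict Implicit.
Unset Printing Implicit Defensive.

(** * Euclidean geometry of triangles *)

Section Euclid.
Variable R : realType.
Implicit Types (x y z e f g v : E3 R) (a b s : R).

(** The obstacle is the size of a star. Shape regularity compares two consecutive edges only, so a
    star of [n] triangles gets a ratio of order [gamma ^ n]. The lower bound on angles does not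
    bound [n], since the angles at a vertex of a polyhedral surface may add up to far more than a
    full turn. Embeddedness has to enter, and it does so through the injectivity of the projection.
    That argument counts small triangles only, which is enough: once a walk around the star leaves
    them, the edge lengths lie between a fixed threshold and a bound on the size of the initial
    surface.

    Working at time 0 requires the quadratic estimate for one compact surface instead of a version
    uniform in time. The resulting ratio [Lam] is chosen before the mesh. It affects only [C2]; [C0]
    and [C1] are both [L2 * gamma / 2]. *)

Lemma dotpE x y :
  dotp x y = x 0 0 * y 0 0 + x 0 1 * y 0 1 + x 0 2%:R * y 0 2%:R.
Proof.
rewrite /dotp !big_ord_recl big_ord0 addr0 addrA.
congr (x 0 _ * y 0 _ + x 0 _ * y 0 _ + x 0 _ * y 0 _); exact/val_inj.
Qed.

Lemma row3P x y : x 0 0 = y 0 0 -> x 0 1 = y 0 1 -> x 0 2%:R = y 0 2%:R -> x = y.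
Proof.
move=> h0 h1 h2; apply/rowP => -[[|[|[|k]]] hk] //.
- by rewrite (_ : Ordinal hk = 0) //; exact/val_inj.
- by rewrite (_ : Ordinal hk = 1) //; exact/val_inj.
- by rewrite (_ : Ordinal hk = 2%:R) //; exact/val_inj.
Qed.

Lemma crossE x y : [/\ cross x y 0 0 = x 0 1 * y 0 2%:R - x 0 2%:R * y 0 1,
  cross x y 0 1 = x 0 2%:R * y 0 0 - x 0 0 * y 0 2%:R &
  cross x y 0 2%:R = x 0 0 * y 0 1 - x 0 1 * y 0 0].
Proof.
rewrite /cross !mxE.
have -> : (1 + 1 : 'I_3) = 2%:R by exact/val_inj.
have -> : (0 + 2%:R : 'I_3) = 2%:R by exact/val_inj.
have -> : (1 + 2%:R : 'I_3) = 0 by exact/val_inj.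
have -> : (2%:R + 1 : 'I_3) = 0 by exact/val_inj.
have -> : (2%:R + 2%:R : 'I_3) = 1 by exact/val_inj.
by have -> : (0 + 1 : 'I_3) = 1 by exact/val_inj.
Qed.

Lemma dotpC x y : dotp x y = dotp y x.
Proof. by rewrite !dotpE; ring. Qed.
Lemma dotpDl x y z : dotp (x + y) z = dotp x z + dotp y z.
Proof. by rewrite !dotpE !mxE; ring. Qed.
Lemma dotpDr x y z : dotp x (y + z) = dotp x y + dotp x z.
Proof. by rewrite !dotpE !mxE; ring. Qed.
Lemma dotpNl x y : dotp (- x) y = - dotp x y.
Proof. by rewrite !dotpE !mxE; ring. Qed.
Lemma dotpNr x y : dotp x (- y) = - dotp x y.
Proof. by rewrite !dotpE !mxE; ring. Qed.
Lemma dotpZl s x y : dotp (s *: x) y = s * dotp x y.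
Proof. by rewrite !dotpE !mxE; ring. Qed.
Lemma dotpZr s x y : dotp x (s *: y) = s * dotp x y.
Proof. by rewrite !dotpE !mxE; ring. Qed.
Lemma dot0p x : dotp 0 x = 0.
Proof. by rewrite !dotpE !mxE; ring. Qed.
Definition dotpl := (dotpDl, dotpDr, dotpNl, dotpNr, dotpZl, dotpZr).

Lemma dotpp_ge0 x : 0 <= dotp x x.
Proof. by rewrite dotpE; nra. Qed.
Lemma dotpp_eq0 x : dotp x x = 0 -> x = 0.
Proof.
rewrite dotpE => h; apply: row3P; rewrite !mxE; nra.
Qed.

Lemma enorm_ge0 x : 0 <= enorm x.
Proof. exact: sqrtr_ge0. Qed.
Lemma sqr_enorm x : enorm x ^+ 2 = dotp x x.
Proof. by rewrite sqr_sqrtr // dotpp_ge0. Qed.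
Lemma enorm_eq x a : 0 <= a -> dotp x x = a ^+ 2 -> enorm x = a.
Proof. by move=> a0 h; rewrite /enorm h sqrtr_sqr ger0_norm. Qed.
Lemma enorm0 : enorm (0 : E3 R) = 0.
Proof. by apply: enorm_eq => //; rewrite dot0p expr0n. Qed.
Lemma enorm_eq0 x : enorm x = 0 -> x = 0.
Proof. by move=> h; apply: dotpp_eq0; rewrite -sqr_enorm h expr0n. Qed.
Lemma enorm_gt0 x : x != 0 -> 0 < enorm x.
Proof.
move=> x0; rewrite lt_neqAle enorm_ge0 andbT eq_sym.
by apply: contra x0 => /eqP/enorm_eq0 ->.
Qed.
Lemma enormZ s x : enorm (s *: x) = `|s| * enorm x.
Proof.
apply: enorm_eq; first by rewrite mulr_ge0 // enorm_ge0.
by rewrite exprMn sqr_enorm real_normK ?num_real // !dotpl mulrA.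
Qed.
Lemma enormN x : enorm (- x) = enorm x.
Proof. by rewrite -scaleN1r enormZ normrN1 mul1r. Qed.
Lemma enormB x y : enorm (x - y) = enorm (y - x).
Proof. by rewrite -enormN opprB. Qed.

(** Lagrange's identity; the sign of its left-hand side gives the Cauchy-Schwarz inequality
    [dotp_le]. *)
Lemma dotp_cross x y : dotp (cross x y) (cross x y) =
  dotp x x * dotp y y - dotp x y ^+ 2.
Proof. by rewrite !dotpE; case: (crossE x y) => -> -> ->; ring. Qed.

Lemma dotp_crossl x y : dotp x (cross x y) = 0.
Proof. by rewrite !dotpE; case: (crossE x y) => -> -> ->; ring. Qed.
Lemma dotp_crossr x y : dotp y (cross x y) = 0.
Proof. by rewrite !dotpE; case: (crossE x y) => -> -> ->; ring. Qed.

Lemma cross_cross x y z : cross x (cross y z) = dotp x z *: y - dotp x y *: z.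
Proof.
case: (crossE x (cross y z)); case: (crossE y z) => -> -> -> h0 h1 h2.
by apply: row3P; rewrite ?h0 ?h1 ?h2 !mxE !dotpE; ring.
Qed.

Lemma crossDr x y : cross x (x + y) = cross x y.
Proof.
case: (crossE x y) => a b c; case: (crossE x (x + y)) => d e f.
by apply: row3P; rewrite ?a ?b ?c ?d ?e ?f !mxE; ring.
Qed.

Lemma crossDl x y : cross (x + y) x = cross y x.
Proof.
case: (crossE y x) => a b c; case: (crossE (x + y) x) => d e f.
by apply: row3P; rewrite ?a ?b ?c ?d ?e ?f !mxE; ring.
Qed.

Lemma dotp_le x y : `|dotp x y| <= enorm x * enorm y.
Proof.
have h : dotp x y ^+ 2 <= (enorm x * enorm y) ^+ 2.
  by rewrite exprMn !sqr_enorm -subr_ge0 -dotp_cross dotpp_ge0.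
by rewrite -sqrtr_sqr -[leRHS]ger0_norm ?mulr_ge0 ?enorm_ge0 //
  -[leRHS]sqrtr_sqr ler_sqrt ?sqr_ge0.
Qed.

Lemma enormD x y : enorm (x + y) <= enorm x + enorm y.
Proof.
rewrite -(@ler_pXn2r _ 2) ?nnegrE ?addr_ge0 ?enorm_ge0 //.
rewrite sqr_enorm !dotpl sqrrD !sqr_enorm (dotpC y x).
have /ler_normlP[_] := dotp_le x y; lra.
Qed.

Lemma enorm_triangle z x y : enorm (x - y) <= enorm (x - z) + enorm (z - y).
Proof. by rewrite -[x - y](subrKA z); apply: le_trans (enormD _ _). Qed.

Lemma enorm_sum (I : finType) (P : pred I) (F : I -> E3 R) :
  enorm (\sum_(i | P i) F i) <= \sum_(i | P i) enorm (F i).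
Proof.
elim/big_ind2 : _ => [|x a y b xa yb|//]; first by rewrite enorm0.
by apply: le_trans (enormD _ _) (lerD _ _).
Qed.

Lemma enorm_coord x k : `|x 0 k| <= enorm x.
Proof.
rewrite -sqrtr_sqr ler_wsqrtr // /dotp (bigD1 k) //= expr2 lerDl.
by apply: sumr_ge0 => j _; rewrite -expr2 sqr_ge0.
Qed.

Lemma enorm_le_coord x : enorm x <= `|x 0 0| + `|x 0 1| + `|x 0 2%:R|.
Proof.
rewrite -(@ler_pXn2r _ 2) ?nnegrE ?addr_ge0 ?enorm_ge0 //.
rewrite sqr_enorm dotpE -!expr2.
rewrite -(real_normK (num_real (x 0 0))) -(real_normK (num_real (x 0 1))).
rewrite -(real_normK (num_real (x 0 2%:R))).
have := normr_ge0 (x 0 0); have := normr_ge0 (x 0 1); have := normr_ge0 (x 0 2%:R).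
nra.
Qed.

Lemma indep_cross e f :
  (forall a b, a *: e + b *: f = 0 -> a = 0 /\ b = 0) -> 0 < enorm (cross e f).
Proof.
move=> indep; apply: enorm_gt0; apply/eqP => c0.
have := cross_cross f e f; rewrite c0 => eq0.
have [] := indep (dotp f f) (- dotp f e).
  rewrite scaleNr -eq0; case: (crossE f 0) => h0 h1 h2.
  by apply: row3P; rewrite ?h0 ?h1 ?h2 !mxE; ring.
move=> /dotpp_eq0 f0; have [|_ /eqP] := indep 0 1; last by rewrite oner_eq0.
by rewrite f0 scaler0 scale0r addr0.
Qed.

Lemma cross_combl e f a b : cross (a *: e + b *: f) f = a *: cross e f.
Proof.
case: (crossE (a *: e + b *: f) f) => h0 h1 h2; case: (crossE e f) => k0 k1 k2.
by apply: row3P; rewrite [RHS]mxE ?h0 ?h1 ?h2 ?k0 ?k1 ?k2 !mxE; ring.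
Qed.

Lemma cross_combr e f a b : cross e (a *: e + b *: f) = b *: cross e f.
Proof.
case: (crossE e (a *: e + b *: f)) => h0 h1 h2; case: (crossE e f) => k0 k1 k2.
by apply: row3P; rewrite [RHS]mxE ?h0 ?h1 ?h2 ?k0 ?k1 ?k2 !mxE; ring.
Qed.

Lemma enorm_cross_le e f : enorm (cross e f) <= enorm e * enorm f.
Proof.
rewrite -(@ler_pXn2r _ 2) ?nnegrE ?mulr_ge0 ?enorm_ge0 // exprMn !sqr_enorm.
by rewrite dotp_cross gerBl sqr_ge0.
Qed.

(** Balls and limits of the library are those of the sup norm; this lets Euclidean estimates control
    them. *)
Lemma norm_le_enorm x : `|x| <= enorm x.
Proof.
rewrite /Num.norm /= mx_normrE; apply: bigmax_le; first exact: enorm_ge0.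
by move=> [i k] _ /=; rewrite (ord1 i) enorm_coord.
Qed.

End Euclid.

(** * Shape-regular triangles and inscribed circles *)

Section Fat.
Variable R : realType.
Implicit Types (e f p v : E3 R) (gamma h : R).

(* For a triangle of diameter [h] with sides [e] and [f] at a vertex, the last
   two bounds say that the heights over these sides are at least [2 h / gamma]. *)
Definition fat gamma h e f : Prop :=
  [/\ 0 < enorm e <= h, 0 < enorm f <= h, enorm (e - f) <= h,
      2%:R * h * enorm e <= gamma * enorm (cross e f)
    & 2%:R * h * enorm f <= gamma * enorm (cross e f)].

Section FatFacts.
Variables (gamma h : R) (e f : E3 R).
Hypotheses (g0 : 0 < gamma) (fef : fat gamma h e f).

Lemma fat_gt0 : 0 < h.
Proof. by case: fef => /andP[e0 /(lt_le_trans e0)]. Qed.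

Lemma fat_el : 2%:R * h <= gamma * enorm e.
Proof.
case: fef => _ /andP[f0 _] _ _ le2; rewrite -(ler_pM2r f0).
by rewrite (le_trans le2) // -mulrA ler_pM2l // enorm_cross_le.
Qed.

Lemma fat_er : 2%:R * h <= gamma * enorm f.
Proof.
case: fef => /andP[e0 _] _ _ le2 _; rewrite -(ler_pM2r e0).
by rewrite (le_trans le2) // -mulrA ler_pM2l // mulrC enorm_cross_le.
Qed.

Lemma fat_cross_gt0 : 0 < enorm (cross e f).
Proof.
case: fef => /andP[e0 _] _ _ le1 _; rewrite -(pmulr_rgt0 _ g0).
by apply: lt_le_trans le1; rewrite !mulr_gt0 // fat_gt0.
Qed.

(** With [n = cross e f] and [p] orthogonal to [n], [|p| |n|] is the length of the double cross
    product [(p.f) e - (p.e) f]; the height bounds then trade [|e|] and [|f|] for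
    [gamma |n| / (2 h)]. Applied to a gradient, this is the source of the constant
    [L2 * gamma / 2]. *)
Lemma fat_plane p : dotp p (cross e f) = 0 ->
  2%:R * h * enorm p <= gamma * (`|dotp p e| + `|dotp p f|).
Proof.
move=> pn.
have c0 := fat_cross_gt0; have h0 := fat_gt0.
have : enorm p * enorm (cross e f) = enorm (cross p (cross e f)).
  apply/esym/enorm_eq; first by rewrite mulr_ge0 ?enorm_ge0.
  by rewrite exprMn !sqr_enorm dotp_cross pn expr0n subr0.
rewrite cross_cross => eqp.
have lep : enorm p * enorm (cross e f) <=
    `|dotp p f| * enorm e + `|dotp p e| * enorm f.
  by rewrite eqp (le_trans (enormD _ _)) // enormN !enormZ.
case: fef => _ _ _ le1 le2.
rewrite -(ler_pM2r c0) -[leLHS]mulrA.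
have h2 : 0 <= 2%:R * h by rewrite mulr_ge0 // ltW.
apply: le_trans (ler_wpM2l h2 lep) _.
rewrite [leRHS](_ : _ = `|dotp p f| * (gamma * enorm (cross e f)) +
  `|dotp p e| * (gamma * enorm (cross e f))); last by ring.
rewrite [leLHS](_ : _ = `|dotp p f| * (2%:R * h * enorm e) +
  `|dotp p e| * (2%:R * h * enorm f)); last by ring.
by apply: lerD; apply: ler_wpM2l.
Qed.

(** The product of the two height bounds gives [(2h)^2 ab <= gamma^2 ((ab)^2 - k^2)] with [k = e.f],
    and [(ab)^2 - k^2] is at most [2ab(ab + k)], the difference being a square. The factor 3 comes
    from [a + b + d <= 3h]. *)
Lemma fat_incircle :
  2%:R * h <= 3%:R * gamma ^+ 2 * ((enorm e + enorm f - enorm (e - f)) / 2%:R).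
Proof.
have c0 := fat_cross_gt0; have h0 := fat_gt0.
case: fef => /andP[e0 eh] /andP[f0 fh] efh le1 le2.
have d0 := enorm_ge0 (e - f).
have dd : enorm (e - f) ^+ 2 = enorm e ^+ 2 + enorm f ^+ 2 - 2%:R * dotp e f.
  by rewrite !sqr_enorm !dotpl (dotpC f e); ring.
have cc : enorm (cross e f) ^+ 2 = enorm e ^+ 2 * enorm f ^+ 2 - dotp e f ^+ 2.
  by rewrite !sqr_enorm dotp_cross.
have le3 : (2%:R * h) ^+ 2 * (enorm e * enorm f) <= gamma ^+ 2 * enorm (cross e f) ^+ 2.
  rewrite -exprMn [leRHS]expr2.
  rewrite [leLHS](_ : _ = (2%:R * h * enorm e) * (2%:R * h * enorm f)); last by ring.
  by apply: ler_pM => //; rewrite !mulr_ge0 // ltW.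
have /ler_normlP[dle1 dle2] := dotp_le e f.
move: e0 eh f0 fh efh d0 dd cc le3 dle1 dle2 {le1 le2}.
move: (enorm e) (enorm f) (enorm (e - f)) (dotp e f) => a b d k.
move=> a0 ah b0 bh dh d0 dd -> le3 k1 k2.
(* (a+b-d)(a+b+d) = 2(ab+k) and (ab+k)(ab-k) = |e x f|^2 *)
have ab0 : 0 < a * b by rewrite mulr_gt0.
have g2 : 0 < gamma ^+ 2 by rewrite exprn_gt0.
have le4 : (2%:R * h) ^+ 2 <= gamma ^+ 2 * (2%:R * (a * b + k)).
  rewrite -(ler_pM2r ab0) (le_trans le3) // -[leRHS]mulrA ler_pM2l //.
  rewrite -subr_ge0 (_ : _ - _ = (a * b + k) ^+ 2) ?sqr_ge0 //; ring.
have eq1 : 2%:R * (a * b + k) = (a + b - d) * (a + b + d).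
  by rewrite -subr_sqr dd; ring.
have s0 : 0 <= a + b - d.
  have P0 : 0 < a + b + d by lra.
  by rewrite -(pmulr_lge0 _ P0) -eq1; nra.
have le5 : gamma ^+ 2 * (2%:R * (a * b + k)) <= gamma ^+ 2 * ((a + b - d) * (3%:R * h)).
  rewrite eq1 ler_pM2l //; apply: ler_wpM2l; [exact: s0 | lra].
rewrite -(ler_pM2r h0).
have := le_trans le4 le5.
set X := gamma ^+ 2; nra.
Qed.

End FatFacts.

(* With a, b, d the side lengths, [(a + b - d) / 2] is the tangent length at
   the common origin of [e] and [f]; the incentre is [(b e + a f) / (a + b + d)]. *)
Lemma incircle_exists e f (a := enorm e) (b := enorm f) (d := enorm (e - f)) :
    0 < a -> 0 < b -> 0 < d ->
  let P := a + b + d in let c := (b / P) *: e + (a / P) *: f in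
  let s := (a + b - d) / 2%:R in let t := (a + d - b) / 2%:R in
  let p := (s / a) *: e in let q' := (s / b) *: f in
  let q := e + (t / d) *: (f - e) in
  [/\ dotp (p - c) e = 0, dotp (q' - c) f = 0, dotp (q - c) (f - e) = 0,
      enorm (p - c) = enorm (q' - c) & enorm (q - c) = enorm (p - c)].
Proof.
move=> a0 b0 d0.
have ee : dotp e e = a ^+ 2 by rewrite sqr_enorm.
have ff : dotp f f = b ^+ 2 by rewrite sqr_enorm.
have ef : dotp e f = (a ^+ 2 + b ^+ 2 - d ^+ 2) / 2%:R.
  by rewrite !sqr_enorm !dotpl (dotpC f e); field.
have an : a != 0 by rewrite gt_eqF.
have bn : b != 0 by rewrite gt_eqF.
have dn : d != 0 by rewrite gt_eqF.
have Pn : a + b + d != 0 by rewrite gt_eqF // !addr_gt0.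
clearbody a b d; move=> P c s t p q' q; rewrite /q /q' /p /t /s /c /P.
split.
- by rewrite !dotpl (dotpC f e) ee ef; field; rewrite ?an ?Pn.
- by rewrite !dotpl ff ef; field; rewrite ?bn ?Pn.
- by rewrite !dotpl (dotpC f e) ee ff ef; field; rewrite ?dn ?Pn.
- congr Num.sqrt; rewrite !dotpl (dotpC f e) ee ff ef.
  by field; rewrite ?an ?bn ?Pn.
- congr Num.sqrt; rewrite !dotpl (dotpC f e) ee ff ef.
  by field; rewrite ?an ?dn ?Pn.
Qed.

(** By Pythagoras the two tangent segments from a vertex have equal length. At the three vertices
    this reads [s a = (1 - t') b], [(1 - s) a = t d] and [(1 - t) d = t' b], a linear system with
    [s a = (a + b - d) / 2]. *)
Lemma incircle_unique (e f c p q q' : E3 R) (r s t t' : R) :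
  0 <= s <= 1 -> 0 <= t <= 1 -> 0 <= t' <= 1 ->
  p = s *: e -> q = e + t *: (f - e) -> q' = f - t' *: f ->
  enorm (p - c) = r -> enorm (q - c) = r -> enorm (q' - c) = r ->
  dotp (p - c) e = 0 -> dotp (q - c) (f - e) = 0 -> dotp (q' - c) f = 0 ->
  enorm p = (enorm e + enorm f - enorm (e - f)) / 2%:R.
Proof.
move=> /andP[s0 s1] /andP[t0 t1] /andP[t'0 t'1] pE qE q'E pr qr q'r pe qe q'e.
have pyth (u w : E3 R) : dotp u w = 0 -> dotp (u + w) (u + w) = dotp u u + dotp w w.
  by move=> uw; rewrite !dotpl (dotpC w) uw; ring.
have sq (u w : E3 R) : dotp u u = dotp w w -> enorm u = enorm w.
  by rewrite /enorm => ->.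
have q'E2 : q' = (1 - t') *: f by rewrite q'E scalerBl scale1r.
have E1 : enorm p = enorm q'.
  apply: sq; apply: (@addrI _ (r ^+ 2)).
  rewrite -{1}pr -q'r !sqr_enorm.
  have h1 : dotp (p - c) (- p) = 0 by rewrite {2}pE dotpNr dotpZr pe mulr0 oppr0.
  have h2 : dotp (q' - c) (- q') = 0.
    by rewrite {2}q'E2 dotpNr dotpZr q'e mulr0 oppr0.
  have := pyth _ _ h1; have := pyth _ _ h2.
  have -> : q' - c - q' = - c by rewrite addrAC subrr sub0r.
  have -> : p - c - p = - c by rewrite addrAC subrr sub0r.
  by rewrite !dotpl !opprK => <- <-.
have E2 : enorm (e - p) = enorm (e - q).
  apply: sq; apply: (@addrI _ (r ^+ 2)).
  rewrite -{1}pr -qr !sqr_enorm.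
  have h1 : dotp (p - c) (e - p) = 0.
    have -> : e - p = (1 - s) *: e by rewrite pE scalerBl scale1r.
    by rewrite dotpZr pe mulr0.
  have h2 : dotp (q - c) (e - q) = 0.
    have -> : e - q = - (t *: (f - e)) by rewrite qE opprD addNKr.
    by rewrite dotpNr dotpZr qe mulr0 oppr0.
  have := pyth _ _ h1; have := pyth _ _ h2.
  have -> : q - c + (e - q) = e - c by rewrite addrC addrA subrK.
  have -> : p - c + (e - p) = e - c by rewrite addrC addrA subrK.
  by move=> <- <-.
have E3 : enorm (f - q) = enorm (f - q').
  apply: sq; apply: (@addrI _ (r ^+ 2)).
  rewrite -{1}qr -q'r !sqr_enorm.
  have h1 : dotp (q' - c) (f - q') = 0.
    have -> : f - q' = t' *: f by rewrite q'E opprD addrA subrr sub0r opprK.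
    by rewrite dotpZr q'e mulr0.
  have h2 : dotp (q - c) (f - q) = 0.
    have -> : f - q = (1 - t) *: (f - e).
      by rewrite qE scalerBl scale1r opprD addrA.
    by rewrite dotpZr qe mulr0.
  have := pyth _ _ h1; have := pyth _ _ h2.
  have -> : q - c + (f - q) = f - c by rewrite addrC addrA subrK.
  have -> : q' - c + (f - q') = f - c by rewrite addrC addrA subrK.
  by move=> <- <-.
have n1 : enorm p = s * enorm e by rewrite pE enormZ ger0_norm.
have n2 : enorm (e - p) = (1 - s) * enorm e.
  by rewrite pE -{1}[e]scale1r -scalerBl enormZ ger0_norm // subr_ge0.
have n3 : enorm (e - q) = t * enorm (e - f).
  by rewrite qE opprD addNKr enormN enormZ ger0_norm // enormB.
have n4 : enorm (f - q) = (1 - t) * enorm (e - f).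
  have -> : f - q = (1 - t) *: (f - e).
    by rewrite qE scalerBl scale1r opprD addrA.
  by rewrite enormZ ger0_norm ?subr_ge0 // enormB.
have n5 : enorm (f - q') = t' * enorm f.
  by rewrite q'E opprD addrA subrr sub0r opprK enormZ ger0_norm.
have n6 : enorm q' = (1 - t') * enorm f.
  by rewrite q'E -{1}[f]scale1r -scalerBl enormZ ger0_norm // subr_ge0.
lra.
Qed.

End Fat.

(** * Hull, diameter and inradius of a mesh triangle *)

Section Tri.
Variables (R : realType) (M : nat) (x : 'I_M -> E3 R).
Implicit Types (i a b : 'I_M) (y z : E3 R).

Lemma sum_set2 (V : nmodType) a b (F : 'I_M -> V) : a != b ->
  \sum_(k in [set a; b]%SET) F k = F a + F b.
Proof. by move=> ab; rewrite big_setU1 ?inE ?big_set1. Qed.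

Lemma sum_set3 (V : nmodType) i a b (F : 'I_M -> V) :
  i != a -> i != b -> a != b ->
  \sum_(k in [set i; a; b]%SET) F k = F i + F a + F b.
Proof.
move=> ia ib ab; rewrite (finset.setUC [set i; a]%SET) big_setU1 /=; last first.
  by rewrite !inE negb_or eq_sym ib eq_sym ab.
by rewrite sum_set2 // addrC.
Qed.

Definition wt3 i a b (r s t : R) : 'I_M -> R :=
  fun k => if k == i then r else if k == a then s else if k == b then t else 0.

Lemma wt3E i a b r s t : i != a -> i != b -> a != b ->
  [/\ wt3 i a b r s t i = r, wt3 i a b r s t a = s & wt3 i a b r s t b = t].
Proof.
rewrite /wt3 => ia ib ab; rewrite !eqxx (eq_sym a i) (negbTE ia).
by rewrite (eq_sym b i) (negbTE ib) (eq_sym b a) (negbTE ab).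
Qed.

Lemma comb3E (r s t : R) (p q z : E3 R) : r + s + t = 1 ->
  r *: p + s *: q + t *: z = p + s *: (q - p) + t *: (z - p).
Proof.
move=> rst; have -> : r = 1 - s - t by rewrite -rst; ring.
by apply: row3P; rewrite !mxE; ring.
Qed.

Lemma comb2B (s t s' t' : R) (p e f : E3 R) :
  (p + s *: e + t *: f) - (p + s' *: e + t' *: f) = (s - s') *: e + (t - t') *: f.
Proof. by apply: row3P; rewrite !mxE; ring. Qed.

Section Three.
Variables i a b : 'I_M.
Hypotheses (ia : i != a) (ib : i != b) (ab : a != b).
Notation K := [set i; a; b]%SET.

Lemma hull3P y : hull x K y <-> exists s t : R,
  [/\ 0 <= s, 0 <= t, s + t <= 1
    & y = x i + s *: (x a - x i) + t *: (x b - x i)].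
Proof.
split=> [[w [w0 ws ->]]|[s [t [s0 t0 st ->]]]].
  rewrite !sum_set3 // in ws *; exists (w a), (w b); split=> //.
    by rewrite -ws -addrA lerDr.
  exact: comb3E.
have [wi wa wb] := @wt3E i a b (1 - s - t) s t ia ib ab.
exists (wt3 i a b (1 - s - t) s t); rewrite !sum_set3 // wi wa wb.
split; last by rewrite comb3E //; ring.
  by move=> k; rewrite /wt3; do 3?case: ifP => // _; lra.
by ring.
Qed.

Lemma aff3P y : aff x K y <-> exists s t : R,
  y = x i + s *: (x a - x i) + t *: (x b - x i).
Proof.
split=> [[w [ws ->]]|[s [t ->]]].
  by rewrite !sum_set3 // in ws *; exists (w a), (w b); exact: comb3E.
have [wi wa wb] := @wt3E i a b (1 - s - t) s t ia ib ab.
exists (wt3 i a b (1 - s - t) s t); rewrite !sum_set3 // wi wa wb.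
by split; [ring | rewrite comb3E //; ring].
Qed.

Lemma aff_independent3 : aff_independent x K ->
  forall u v : R, u *: (x a - x i) + v *: (x b - x i) = 0 -> u = 0 /\ v = 0.
Proof.
move=> hK u v uv.
have [wi wa wb] := @wt3E i a b (- u - v) u v ia ib ab.
have := hK (wt3 i a b (- u - v) u v); rewrite !sum_set3 // wi wa wb.
have h1 : - u - v + u + v = 0 by ring.
have h2 : (- u - v) *: x i + u *: x a + v *: x b = 0.
  by rewrite -uv; apply: row3P; rewrite !mxE; ring.
move=> /(_ h1 h2) h; split; [move: (h a) | move: (h b)].
  by rewrite wa; apply; rewrite !inE eqxx orbT.
by rewrite wb; apply; rewrite !inE eqxx orbT.
Qed.

End Three.

Lemma hull2P a b (ab : a != b) y :
  hull x [set a; b]%SET y <-> exists2 s : R, 0 <= s <= 1 & y = x a + s *: (x b - x a).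
Proof.
split=> [[w [w0]]|[s /andP[s0 s1] ->]].
  rewrite !sum_set2 // => ws ->; exists (w b).
    by rewrite w0 -ws lerDr w0.
  have -> : w a = 1 - w b by rewrite -ws; ring.
  by apply: row3P; rewrite !mxE; ring.
exists (fun k => if k == a then 1 - s else if k == b then s else 0).
rewrite !sum_set2 // !eqxx eq_sym (negbTE ab); split.
- by move=> k; do 2?case: ifP => // _; lra.
- by ring.
- by apply: row3P; rewrite !mxE; ring.
Qed.

Lemma hull_vertex (K : {set 'I_M}) k : k \in K -> hull x K (x k).
Proof.
move=> kK; exists (fun l => (l == k)%:R); split=> [l||].
- exact: ler0n.
- rewrite (bigD1 k) //= eqxx big1 ?addr0 // => l /andP[_ /negbTE ->] //.
- rewrite (bigD1 k) //= eqxx scale1r big1 ?addr0 // => l /andP[_ /negbTE ->].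
  by rewrite scale0r.
Qed.

Lemma hull_bound (K : {set 'I_M}) y : hull x K y ->
  enorm y <= \sum_(k in K) enorm (x k).
Proof.
case=> w [w0 ws ->]; apply: le_trans (enorm_sum _ _) _.
apply: ler_sum => k kK; rewrite enormZ ger0_norm // ler_piMl ?enorm_ge0 //.
by rewrite -ws (bigD1 k) //= lerDl sumr_ge0.
Qed.

Lemma has_sup_diam (K : {set 'I_M}) k : k \in K ->
  has_sup [set r | exists y z, [/\ hull x K y, hull x K z & r = enorm (y - z)]].
Proof.
move=> kK; split.
  exists (enorm (x k - x k)); exists (x k), (x k).
  by split=> //; exact: hull_vertex.
exists (\sum_(k in K) enorm (x k) + \sum_(k in K) enorm (x k)) => _ [y [z [hy hz ->]]].
by apply: le_trans (enormD _ _) _; rewrite enormN lerD // hull_bound.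
Qed.

Lemma diam_hull (K : {set 'I_M}) y z : hull x K y -> hull x K z ->
  enorm (y - z) <= diam (hull x K).
Proof.
move=> hy hz; have [k kK] : exists k, k \in K.
  case: hy => w [_ ws _]; apply: contrapT => nK.
  move: ws; rewrite big1 => [/esym/eqP|k kK]; first by rewrite oner_eq0.
  by case: nK; exists k.
by apply: sup_upper_bound; [exact: has_sup_diam kK | exists y, z].
Qed.

Lemma inradius_adherent (K : {set 'I_M}) (r : R) : 0 <= r -> r < inradius x K ->
  exists2 c, hull x K c & forall y, aff x K y -> enorm (y - c) <= r -> hull x K y.
Proof.
move=> r0; rewrite /inradius; set A := [set _ | _] => rA.
(* A set without supremum has [sup] equal to 0 by convention, which [0 <= r < sup A] excludes. *)
have supA : has_sup A.
  by apply: contrapT => /sup_out supA; move: rA; rewrite supA ltNge r0.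
have [r' [_ [c hc hr']]] : exists2 r', A r' & sup A - (sup A - r) < r'.
  by apply: sup_adherent => //; rewrite subr_gt0.
rewrite subKr => rr'; exists c => // y yK yc.
by apply: hr' => //; apply: le_trans yc (ltW rr').
Qed.

Section Shape.
Variables i a b : 'I_M.
Hypotheses (ia : i != a) (ib : i != b) (ab : a != b).
Notation K := [set i; a; b]%SET.
Hypothesis (hK : aff_independent x K).

Lemma aff_independent_neq0 : [/\ x a - x i != 0, x b - x i != 0
  & (x a - x i) - (x b - x i) != 0].
Proof.
have h := aff_independent3 ia ib ab hK.
split; apply/eqP => e0.
- have [|/eqP] := h 1 0; first by rewrite e0 scaler0 scale0r addr0.
  by rewrite oner_eq0.
- have [|_ /eqP] := h 0 1; first by rewrite e0 scaler0 scale0r addr0.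
  by rewrite oner_eq0.
- have [|/eqP] := h 1 (- 1); first by rewrite scale1r scaleN1r.
  by rewrite oner_eq0.
Qed.

Lemma aff_independent_cross : 0 < enorm (cross (x a - x i) (x b - x i)).
Proof.
exact: indep_cross (aff_independent3 ia ib ab hK).
Qed.

(* A disc contained in the triangle fits between the side [f] and the parallel
   line through the opposite vertex. *)
Lemma disc_side (r : R) : 0 <= r -> r < inradius x K ->
  2%:R * r * enorm (x b - x i) <= enorm (cross (x a - x i) (x b - x i)).
Proof.
move=> r0 /(inradius_adherent r0)[c hc disc].
have C0 := aff_independent_cross; have [_ /enorm_gt0 f0 _] := aff_independent_neq0.
move: C0 f0; set e := x a - x i; set f := x b - x i => C0 f0.
(* [w] lies in the plane of the triangle and is orthogonal to [f]. Both ends of the diameter of the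
   disc along [w] have their coordinate on [e] in [[0, 1]]; pairing their difference with [w] gives
   [2 r |w| = (s - s') |cross e f|^2]. *)
set w := cross f (cross e f).
have wE : w = dotp f f *: e - dotp f e *: f by exact: cross_cross.
have wn : enorm w = enorm f * enorm (cross e f).
  apply: enorm_eq; first by rewrite mulr_ge0 ?enorm_ge0.
  by rewrite dotp_cross dotp_crossr exprMn !sqr_enorm expr0n subr0.
have w0 : 0 < enorm w by rewrite wn mulr_gt0.
have [sc [tc [_ _ _ cE]]] := (hull3P ia ib ab c).1 hc.
have hq (k : R) : `|k| = r / enorm w -> exists s t : R,
    [/\ 0 <= s, s <= 1 & c + k *: w = x i + s *: e + t *: f].
  move=> kr.
  have /(hull3P ia ib ab)[s [t [s0 t0 st E]]] : hull x K (c + k *: w).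
    apply: disc; last first.
      by rewrite addrC addKr enormZ kr mulrVK ?unitfE ?gt_eqF.
    apply/(aff3P ia ib ab); exists (sc + k * dotp f f), (tc - k * dotp f e).
    rewrite {1}cE wE -/e -/f; apply: row3P; rewrite !mxE; ring.
  by exists s, t; split => //; lra.
have kp : 0 <= r / enorm w by rewrite divr_ge0 // ltW.
have [s [t [s0 s1 E]]] := hq (r / enorm w) (ger0_norm kp).
have [|s' [t' [s'0 s'1 E']]] := hq (- (r / enorm w)); first by rewrite normrN ger0_norm.
have fw : dotp f w = 0 by rewrite dotp_crossl.
have ew : dotp e w = enorm (cross e f) ^+ 2.
  by rewrite wE dotpDr dotpNr !dotpZr sqr_enorm dotp_cross (dotpC f e); ring.
have : 2%:R * r * enorm w = (s - s') * enorm (cross e f) ^+ 2.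
  transitivity (dotp (c + (r / enorm w) *: w - (c + (- (r / enorm w)) *: w)) w).
    rewrite opprD addrACA subrr add0r -scalerBl dotpZl -sqr_enorm; field; exact: lt0r_neq0.
  rewrite E E' comb2B dotpDl !dotpZl fw ew; ring.
rewrite wn !mulrA => eq1.
rewrite -(ler_pM2r C0) eq1 -mulrA ler_piMl ?mulr_ge0 ?enorm_ge0 //; lra.
Qed.

Lemma inradius_side : 
  2%:R * inradius x K * enorm (x b - x i) <= enorm (cross (x a - x i) (x b - x i)).
Proof.
have C0 := aff_independent_cross; have [_ /enorm_gt0 f0 _] := aff_independent_neq0.
rewrite leNgt; apply/negP => lt1.
set C := enorm (cross _ _) in C0 lt1; set F := enorm (x b - x i) in f0 lt1.
have lt2 : C / (2%:R * F) < inradius x K.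
  by rewrite ltr_pdivrMr ?mulr_gt0 // mulrA (mulrC _ 2%:R).
have [] := midf_lt lt2; set r := _ / 2%:R => r1 r2.
have r0 : 0 <= r by apply: ltW; apply: lt_trans r1; rewrite divr_gt0 ?mulr_gt0.
have := disc_side r0 r2; rewrite -/C -/F.
rewrite ltr_pdivrMr ?mulr_gt0 // in r1; nra.
Qed.
End Shape.

(** Each height is at least twice the inradius, by [inradius_side] read in both orders of [a] and
    [b]. Mesh regularity is used later only through [fat]. *)
Lemma fat_tri gamma i a b : i != a -> i != b -> a != b -> 0 < gamma ->
  aff_independent x [set i; a; b]%SET ->
  diam (hull x [set i; a; b]%SET) <= gamma * inradius x [set i; a; b]%SET ->
  fat gamma (diam (hull x [set i; a; b]%SET)) (x a - x i) (x b - x i).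
Proof.
move=> ia ib ab g0 hK reg; have [e0 f0 _] := aff_independent_neq0 ia ib ab hK.
have Ki : i \in [set i; a; b]%SET by rewrite !inE eqxx.
have Ka : a \in [set i; a; b]%SET by rewrite !inE eqxx orbT.
have Kb : b \in [set i; a; b]%SET by rewrite !inE eqxx orbT.
have sw : [set i; b; a]%SET = [set i; a; b]%SET by rewrite -!finset.setUA (finset.setUC [set b]%SET).
have crossC : enorm (cross (x b - x i) (x a - x i)) =
    enorm (cross (x a - x i) (x b - x i)).
  by rewrite /enorm !dotp_cross (dotpC (x b - x i) (x a - x i)) (mulrC (dotp _ _)).
split.
- by rewrite enorm_gt0 //=; apply: diam_hull; exact: hull_vertex.
- by rewrite enorm_gt0 //=; apply: diam_hull; exact: hull_vertex.
- rewrite opprB addrA subrK; apply: diam_hull; exact: hull_vertex.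
- have := @inradius_side i b a ib ia; rewrite sw crossC eq_sym => /(_ ab hK) h.
  apply: le_trans (ler_wpM2l (ltW g0) h).
  by rewrite !mulrA ler_wpM2r ?enorm_ge0 // (mulrC gamma) -mulrA ler_pM2l.
- apply: le_trans (ler_wpM2l (ltW g0) (inradius_side ia ib ab hK)).
  by rewrite !mulrA ler_wpM2r ?enorm_ge0 // (mulrC gamma) -mulrA ler_pM2l.
Qed.

End Tri.

(** Cramer's rule; the Gram determinant is the square of [|cross e f|]. *)
Lemma gram_solve (R : realType) (e f : E3 R) (A B : R) :
  0 < enorm (cross e f) -> exists s t,
    dotp (s *: e + t *: f) e = A /\ dotp (s *: e + t *: f) f = B.
Proof.
move=> C0; have G0 : dotp e e * dotp f f - dotp e f ^+ 2 != 0.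
  by rewrite -dotp_cross -sqr_enorm expf_neq0 // gt_eqF.
exists ((A * dotp f f - B * dotp e f) / (dotp e e * dotp f f - dotp e f ^+ 2)).
exists ((B * dotp e e - A * dotp e f) / (dotp e e * dotp f f - dotp e f ^+ 2)).
by rewrite !(dotpDl, dotpZl) (dotpC f e); split; field.
Qed.

(** * Contact point, corner and gradient in one triangle *)

Section Cell.
Variables (R : realType) (M : nat) (x : 'I_M -> E3 R) (i a b : 'I_M).
Hypotheses (ia : i != a) (ib : i != b) (ab : a != b).
Notation K := [set i; a; b]%SET.
Hypothesis (hK : aff_independent x K).
Implicit Types (u : E3 R -> R) (d r s t : R) (y z g p q c : E3 R).

Let e := x a - x i.
Let f := x b - x i.

Let C0 : 0 < enorm (cross e f) := aff_independent_cross ia ib ab hK.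

(** [contact] selects some tangency point and falls back on [x i] if there is none.
    [incircle_exists] rules out the default, and [incircle_unique] makes the selection
    immaterial. *)
Lemma contactE :
  enorm (contact x i a b - x i) = (enorm e + enorm f - enorm (e - f)) / 2%:R.
Proof.
have [/enorm_gt0 + /enorm_gt0 + /enorm_gt0] := aff_independent_neq0 ia ib ab hK.
rewrite -/e -/f => e0 f0 d0.
have t1 : enorm (e - f) <= enorm e + enorm f by rewrite -(enormN f) enormD.
have t2 : enorm e <= enorm (e - f) + enorm f.
  by rewrite -{1}(subrK f e) enormD.
have t3 : enorm f <= enorm e + enorm (e - f).
  by rewrite -(enormB f e) -{1}(addrNK e f) addrC enormD.
have frac (k l : R) : 0 <= k -> k <= l -> 0 < l -> 0 <= k / l <= 1.
  by move=> k0 kl l0; rewrite divr_ge0 ?ler_pdivrMr ?mul1r ?(ltW l0).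
have bi : b != i by rewrite eq_sym.
have xbi : x b - x a = f - e by rewrite /f /e opprB addrA subrK.
have ex : exists p c r q (q' : E3 R), [/\ hull x K c, touches x c r i a p, touches x c r a b q
    & touches x c r b i q'].
  have := incircle_exists e0 f0 d0; rewrite /=.
  set P := enorm e + enorm f + enorm (e - f); set c := _ *: e + _ *: f.
  set s := (_ + _ - _) / _; set t := (_ + _ - _) / _.
  set p := _ *: e; set q' := _ *: f; set q := e + _ => -[h1 h2 h3 h4 h5].
  exists (x i + p), (x i + c), (enorm (p - c)), (x i + q), (x i + q').
  have P0 : 0 < P by rewrite !addr_gt0.
  split.
  - apply/(hull3P x ia ib ab); exists (enorm f / P), (enorm e / P); split.
    + by rewrite divr_ge0 // ltW.
    + by rewrite divr_ge0 // ltW.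
    + by rewrite -mulrDl ler_pdivrMr // mul1r /P; lra.
    + by rewrite addrA.
  - split; rewrite ?addrKA //; first last.
      by rewrite opprD addrACA subrr add0r.
      by rewrite opprD addrACA subrr add0r.
    apply/(hull2P x ia); exists (s / enorm e) => //.
    by apply: frac; rewrite // /s; lra.
  - split; first last.
    + by rewrite opprD addrACA subrr add0r xbi.
    + by rewrite opprD addrACA subrr add0r.
    apply/(hull2P x ab); exists (t / enorm (e - f)).
      by apply: frac; rewrite // /t; lra.
    by rewrite xbi /q addrA addrCA subrr addr0.
  - split; first last.
    + by rewrite -[x i - x b]opprB dotpNr -/f opprD addrACA subrr add0r h2 oppr0.
    + by rewrite opprD addrACA subrr add0r -h4.
    apply/(hull2P x bi); exists (1 - s / enorm f).
      have /andP[] : 0 <= s / enorm f <= 1 by apply: frac; rewrite // /s; lra.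
      lra.
    rewrite /q' /f; apply: row3P; rewrite !mxE; ring.
rewrite /contact; case: xgetP => [p _ [c [r [q [q' [_ [hp pr pe] [hq qr qe] [hq' q'r q'e]]]]]]|]; last first.
  by case: ex => p hp /(_ p).
have [s s01 pE] := (hull2P x ia p).1 hp.
have [t t01 qE] := (hull2P x ab q).1 hq.
have [t' t'01 q'E] := (hull2P x bi q').1 hq'.
apply: (@incircle_unique _ e f (c - x i) _ (q - x i) (q' - x i) r s t t') => //.
- by rewrite pE addrC addKr.
- by rewrite qE xbi /e addrAC.
- by rewrite q'E /f; apply: row3P; rewrite !mxE; ring.
- by rewrite -pr; congr enorm; apply: row3P; rewrite !mxE; ring.
- by rewrite -qr; congr enorm; apply: row3P; rewrite !mxE; ring.
- by rewrite -q'r; congr enorm; apply: row3P; rewrite !mxE; ring.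
- by rewrite -pe; congr dotp; apply: row3P; rewrite !mxE; ring.
- by rewrite -xbi -qe; congr dotp; apply: row3P; rewrite !mxE; ring.
- apply/eqP; rewrite -oppr_eq0 -dotpNr opprB -q'e; apply/eqP.
  by congr dotp; apply: row3P; rewrite !mxE; ring.
Qed.

Section Corner.
Variable d : R.
Hypothesis d0 : 0 <= d.
Let p := edge_point x d i a.
Let q := edge_point x d i b.
Let s := corner x d i a b.

Lemma cornerP : [/\ aff x K s, dotp (s - p) e = 0 & dotp (s - q) f = 0].
Proof.
have [/enorm_gt0 + /enorm_gt0 + _] := aff_independent_neq0 ia ib ab hK.
rewrite -/e -/f => e0 f0.
rewrite /s /corner; case: xgetP => [s' _ //|].
have [u [v [ue vf]]] := gram_solve (d * enorm e) (d * enorm f) C0.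
move=> /(_ (x i + u *: e + v *: f)) []; split.
- by apply/(aff3P x ia ib ab); exists u, v.
- rewrite /p /edge_point /edge_len -/e -(addrA (x i)) opprD addrACA subrr add0r dotpDl ue.
  by rewrite dotpNl dotpZl -sqr_enorm; field; rewrite gt_eqF.
- rewrite /q /edge_point /edge_len -/f -(addrA (x i)) opprD addrACA subrr add0r dotpDl vf.
  by rewrite dotpNl dotpZl -sqr_enorm; field; rewrite gt_eqF.
Qed.

Lemma corner_legs : [/\ dotp (s - p) (p - x i) = 0, dotp (s - q) (q - x i) = 0,
  enorm (p - x i) = d & enorm (q - x i) = d].
Proof.
have [/enorm_gt0 + /enorm_gt0 + _] := aff_independent_neq0 ia ib ab hK.
rewrite -/e -/f => e0 f0; have [_ pe qf] := cornerP.
have pE : p - x i = (d / enorm e) *: e by rewrite /p /edge_point addrC addKr.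
have qE : q - x i = (d / enorm f) *: f by rewrite /q /edge_point addrC addKr.
split.
- by rewrite pE dotpZr pe mulr0.
- by rewrite qE dotpZr qf mulr0.
- by rewrite pE enormZ ger0_norm ?divr_ge0 ?(ltW e0) // divfK ?gt_eqF.
- by rewrite qE enormZ ger0_norm ?divr_ge0 ?(ltW f0) // divfK ?gt_eqF.
Qed.

(** Two right triangles share the hypotenuse from [x i] to [s] and have one leg of length [d]. This
    later identifies [hL] with [hR] of the preceding triangle. *)
Lemma corner_leg_eq : enorm (s - q) = enorm (s - p).
Proof.
have [pe qf pd qd] := corner_legs.
have pyth (u w : E3 R) : dotp u w = 0 -> dotp (u + w) (u + w) = dotp u u + dotp w w.
  by move=> uw; rewrite !dotpl (dotpC w) uw; ring.
have := pyth _ _ pe; have := pyth _ _ qf.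
rewrite !subrKA -!(sqr_enorm (_ - x i)) pd qd => -> /addIr.
by rewrite /enorm => ->.
Qed.

(** The diagonal from [x i] to [s] cuts the quadrilateral into two right triangles with legs [d] and
    [|s - p|]. Hence the area weights of the Hamiltonian and the boundary lengths of the diffusion
    are proportional, triangle by triangle. *)
Lemma quad_areaE : quad_area (x i) p s q = d * enorm (s - p).
Proof.
have [pe qf pd qd] := corner_legs.
have cr (u w : E3 R) : dotp w u = 0 -> enorm (cross u (w + u)) = enorm u * enorm w.
  move=> uw; apply: enorm_eq; first by rewrite mulr_ge0 ?enorm_ge0.
  rewrite addrC crossDr dotp_cross (dotpC u w) uw exprMn !sqr_enorm expr0n subr0 //.
have cl (u w : E3 R) : dotp w u = 0 -> enorm (cross (w + u) u) = enorm u * enorm w.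
  move=> uw; apply: enorm_eq; first by rewrite mulr_ge0 ?enorm_ge0.
  rewrite addrC crossDl dotp_cross uw exprMn !sqr_enorm expr0n subr0 mulrC //.
have := cr _ _ pe; have := cl _ _ qf.
rewrite !subrKA /quad_area /tri_area => -> ->.
by rewrite pd qd corner_leg_eq; field.
Qed.
End Corner.

Lemma affine_hull3 u :
  (forall y z s, hull x K y -> hull x K z -> 0 <= s <= 1 ->
     u (s *: y + (1 - s) *: z) = s * u y + (1 - s) * u z) ->
  forall s t, 0 <= s -> 0 <= t -> s + t <= 1 ->
    u (x i + s *: e + t *: f) = u (x i) + s * (u (x a) - u (x i)) + t * (u (x b) - u (x i)).
Proof.
move=> uK s t s0 t0 st.
have Ki : i \in K by rewrite !inE eqxx.
have Ka : a \in K by rewrite !inE eqxx orbT.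
have Kb : b \in K by rewrite !inE eqxx orbT.
have [st0|st0] := eqVneq (s + t) 0.
  have -> : s = 0 by lra.
  have -> : t = 0 by lra.
  by rewrite !scale0r !addr0 !mul0r !addr0.
have hi := hull_vertex x Ki; have ha := hull_vertex x Ka; have hb := hull_vertex x Kb.
(* Affinity is given for two points at a time: the point is reached from [x i] through the point [z]
   of the opposite side. *)
set z := (s / (s + t)) *: x a + (1 - s / (s + t)) *: x b.
have s01 : 0 <= s / (s + t) <= 1.
  have stp : 0 < s + t by rewrite lt0r st0; lra.
  by rewrite divr_ge0 ?ler_pdivrMr //; lra.
have hz : hull x K z.
  apply/(hull3P x ia ib ab); exists (s / (s + t)), (1 - s / (s + t)).
  have /andP[s0' s1'] := s01; split => //; [lra | lra |].
  by rewrite /z; apply: row3P; rewrite !mxE; ring.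
have -> : x i + s *: e + t *: f = (1 - s - t) *: x i + (1 - (1 - s - t)) *: z.
  rewrite /z /e /f; apply: row3P; rewrite !mxE; field => //.
rewrite uK //; last by lra.
rewrite /z uK //; field => //.
Qed.

Lemma tgradP u :
  (forall y z s, hull x K y -> hull x K z -> 0 <= s <= 1 ->
     u (s *: y + (1 - s) *: z) = s * u y + (1 - s) * u z) ->
  let g := tgrad x u i K in
  [/\ dotp g (cross e f) = 0, dotp g e = u (x a) - u (x i)
    & dotp g f = u (x b) - u (x i)].
Proof.
move=> /affine_hull3 uK.
have Ki : i \in K by rewrite !inE eqxx.
have Ka : a \in K by rewrite !inE eqxx orbT.
have Kb : b \in K by rewrite !inE eqxx orbT.
have hi := hull_vertex x Ki; have ha := hull_vertex x Ka; have hb := hull_vertex x Kb.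
rewrite /tgrad; case: xgetP => [g _ [/(aff3P x ia ib ab)[s [t gE]] gu]|].
  split.
  - have -> : g = s *: e + t *: f.
      by apply: (addrI (x i)); rewrite gE addrA.
    by rewrite dotpDl !dotpZl dotp_crossl dotp_crossr !mulr0 addr0.
  - by rewrite -gu.
  - by rewrite -gu.
have [s [t [ge gf]]] := gram_solve (u (x a) - u (x i)) (u (x b) - u (x i)) C0.
move=> /(_ (s *: e + t *: f)) []; split.
  by apply/(aff3P x ia ib ab); exists s, t; rewrite addrA.
move=> y z /(hull3P x ia ib ab)[s1 [t1 [s10 t10 st1 ->]]].
move=> /(hull3P x ia ib ab)[s2 [t2 [s20 t20 st2 ->]]].
rewrite -/e -/f !uK // comb2B dotpDr !dotpZr ge gf; ring.
Qed.

End Cell.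

(** * Quadratic estimate for smooth surfaces *)

Section Calculus.
Variable R : realType.
Implicit Types (n m : E3 R) (s c C : R).

Lemma continuous_dotp n : continuous (fun z : E3 R => dotp z n).
Proof.
rewrite (_ : (fun z => _) = fun z : E3 R =>
    z 0 0 * n 0 0 + z 0 1 * n 0 1 + z 0 2%:R * n 0 2%:R); last first.
  by apply/funext => z; rewrite dotpE.
have ck k : continuous (fun z : E3 R => z 0 k * n 0 k).
  by move=> z; exact: (cvgM (@coord_continuous R 1 3 0 k z) (cvg_cst (n 0 k))).
by move=> z; exact: (cvgD (cvgD (ck 0 z) (ck 1 z)) (ck 2%:R z)).
Qed.

Lemma continuous_dotpp : continuous (fun z : E3 R => dotp z z).
Proof.
rewrite (_ : (fun z => _) = fun z : E3 R =>
    z 0 0 * z 0 0 + z 0 1 * z 0 1 + z 0 2%:R * z 0 2%:R); last first.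
  by apply/funext => z; rewrite dotpE.
have ck k : continuous (fun z : E3 R => z 0 k * z 0 k).
  by move=> z; exact: (cvgM (@coord_continuous R 1 3 0 k z) (@coord_continuous R 1 3 0 k z)).
by move=> z; exact: (cvgD (cvgD (ck 0 z) (ck 1 z)) (ck 2%:R z)).
Qed.

Lemma continuous_enorm : continuous (@enorm R).
Proof.
by move=> z; apply: (continuous_comp (@continuous_dotpp z)); exact: sqrt_continuous.
Qed.

Section Line.
Variables (V : normedModType R) (g : V -> E3 R) (w e : V) (c : R).

Lemma is_derive_dotp_line n s : derivable g (w + (s * c) *: e) e ->
  is_derive s 1 (fun s => dotp (g (w + (s * c) *: e)) n)
    (c * dotp ('D_e g (w + (s * c) *: e)) n).
Proof.
move=> dg.
have dk : is_derive (s * c) 1 (fun r => dotp (g (w + r *: e)) n)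
    (dotp ('D_e g (w + (s * c) *: e)) n).
  have key : (fun h : R => h^-1 *: (((fun r => dotp (g (w + r *: e)) n) \o shift (s * c))
      (h *: 1) - dotp (g (w + (s * c) *: e)) n)) @ 0^'
      --> dotp ('D_e g (w + (s * c) *: e)) n.
    rewrite (_ : (fun h => _) = (fun z => dotp z n) \o
      (fun h : R => h^-1 *: ((g \o shift (w + (s * c) *: e)) (h *: e) -
        g (w + (s * c) *: e)))).
      exact: (cvg_comp _ _ dg (@continuous_dotp n ('D_e g (w + (s * c) *: e)))).
    apply/funext => h /=; rewrite dotpZl dotpDl dotpNl.
    rewrite [h *: (1 : R)]mulr1 [_ *: (_ - _ : R)]/GRing.scale /=.
    by congr (_ * (dotp (g _) _ - _)); rewrite scalerDl addrCA.
  by apply: DeriveDef; [apply/cvg_ex; exists (dotp ('D_e g (w + (s * c) *: e)) n) | exact: cvg_lim key].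
have dm : is_derive s 1 (fun s => s * c) c.
  apply: is_derive_eq; rewrite scaler0 add0r.
  by rewrite /GRing.scale /= mulr1.
rewrite mulrC. exact: (@is_derive1_comp R (fun r => dotp (g (w + r *: e)) n) (fun s => s * c) s _ _ dk dm).
Qed.

(** There is no mean value equality for vector values. The scalar one is applied to the component
    along the defect [n] itself, which gives [|n|^2 = c (D_e g - m).n] at some intermediate
    point. *)
Lemma line_MVT m C : (forall s, 0 <= s <= 1 -> derivable g (w + (s * c) *: e) e /\
    enorm ('D_e g (w + (s * c) *: e) - m) <= C) ->
  enorm (g (w + c *: e) - g w - c *: m) <= C * `|c|.
Proof.
move=> hg; set n := g (w + c *: e) - g w - c *: m.
pose F s := dotp (g (w + (s * c) *: e)) n.
pose dG s := c * dotp ('D_e g (w + (s * c) *: e)) n.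
have dF s : s \in `[0, 1]%R -> is_derive s 1 F (dG s).
  by rewrite in_itv /= => /hg[dg _]; exact: is_derive_dotp_line.
have dFo (s : R) : s \in `]0, 1[%R -> is_derive s 1 F (dG s).
  by move=> s01; apply: dF; exact: subset_itv_oo_cc.
have cF : {within `[0, 1], continuous F}.
  by apply: derivable_within_continuous => s /dF /@ex_derive.
have [s s01] := MVT_segment ler01 dFo cF.
rewrite /F /dG mul1r mul0r scale0r addr0 subr0 mulr1 => eqF.
have nn : enorm n ^+ 2 = c * dotp ('D_e g (w + (s * c) *: e) - m) n.
  rewrite dotpDl mulrDr -eqF sqr_enorm {1}/n !(dotpDl, dotpNl) dotpZl; ring.
have [n0|n0] := eqVneq (enorm n) 0.
  rewrite n0 mulr_ge0 //; have [|_] := hg 0; first by rewrite lexx ler01.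
  exact: le_trans (enorm_ge0 _).
have n0' : 0 < enorm n by rewrite lt0r n0 enorm_ge0.
rewrite -(ler_pM2r n0') -expr2 nn (le_trans (ler_norm _)) // normrM mulrC [leRHS]mulrAC.
rewrite ler_wpM2r //; apply: le_trans (dotp_le _ _) _.
by rewrite ler_wpM2r ?enorm_ge0 //; apply: (hg s _).2; rewrite in_itv in s01.
Qed.
End Line.

End Calculus.

(** * Mean value and Taylor estimates along coordinate paths *)

Section Path.
Variables (R : realType) (n : nat) (V : normedModType R).
Variables (inj : 'rV[R]_n -> V) (E : 'I_n -> V) (g : V -> E3 R).
Hypothesis injD : forall w s k, inj (w + s *: delta_mx 0 k) = inj w + s *: E k.
Implicit Types (w z : 'rV[R]_n) (C : R).

(** The axis-parallel box with opposite corners [w] and [w'], not the segment. [Ck] speaks of one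
    fixed direction at a time and does not include linearity in the direction; coordinate paths call
    on finitely many directions. The map [inj] is the identity for charts and [w |-> (w, t)] for the
    velocity at a frozen time. *)
Definition between w w' z : Prop := forall k, exists2 s : R,
  0 <= s <= 1 & z 0 k = w 0 k + s * (w' 0 k - w 0 k).

(* Join [w] to [w'] by moving one coordinate at a time. *)
Lemma path_MVT w w' (m : 'I_n -> E3 R) C :
  (forall z, between w w' z -> forall k, derivable g (inj z) (E k) /\
     enorm ('D_(E k) g (inj z) - m k) <= C) ->
  enorm (g (inj w') - g (inj w) - \sum_(k < n) (w' 0 k - w 0 k) *: m k)
    <= C * \sum_(k < n) `|w' 0 k - w 0 k|.
Proof.
move=> hg.
pose z l := \row_(k < n) if (k < l)%N then w' 0 k else w 0 k.
suff H l : (l <= n)%N ->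
    enorm (g (inj (z l)) - g (inj w) - \sum_(k < n | (k < l)%N) (w' 0 k - w 0 k) *: m k)
    <= C * \sum_(k < n | (k < l)%N) `|w' 0 k - w 0 k|.
  have := H n (leqnn n).
  rewrite (eq_bigl xpredT); last by move=> k; rewrite ltn_ord.
  rewrite [X in C * X](eq_bigl xpredT); last by move=> k; rewrite ltn_ord.
  by have -> : z n = w' by apply/rowP => k; rewrite mxE ltn_ord.
elim: l => [_|l IH ln].
  rewrite !big_pred0 // mulr0 subr0.
  by have -> : z 0%N = w; [apply/rowP => k; rewrite mxE | rewrite subrr enorm0].
pose k := Ordinal ln.
have splitk (T : nmodType) (F : 'I_n -> T) :
    \sum_(j < n | (j < l.+1)%N) F j = F k + \sum_(j < n | (j < l)%N) F j.
  rewrite (bigD1 k) //=; congr (_ + _); apply: eq_bigl => j.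
  by rewrite ltnS leq_eqVlt -(inj_eq val_inj) /=; case: (ltngtP j l).
rewrite !splitk mulrDr.
have zS : z l.+1 = z l + (w' 0 k - w 0 k) *: delta_mx 0 k.
  apply/rowP => j; rewrite !mxE eqxx /= ltnS leq_eqVlt -(inj_eq val_inj) /=.
  case: (ltngtP j l) => jl /=; rewrite ?mulr0 ?addr0 //.
  have -> : j = k by exact: val_inj.
  by rewrite mulr1 addrC subrK.
have step : enorm (g (inj (z l) + (w' 0 k - w 0 k) *: E k) - g (inj (z l))
    - (w' 0 k - w 0 k) *: m k) <= C * `|w' 0 k - w 0 k|.
  apply: line_MVT => s s01; rewrite -injD; apply: hg => j.
  rewrite !mxE eqxx /= -(inj_eq val_inj) /=.
  case: (ltngtP j l) => jl /=.
  - exists 1; rewrite ?ler01 ?lexx // mul1r mulr0 addr0 addrC subrK //.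
  - by exists 0; rewrite ?ler01 ?lexx // mul0r mulr0 !addr0.
  - by exists s => //; rewrite mulr1 (_ : j = k) //; exact: val_inj.
rewrite -injD -zS in step.
apply: le_trans (lerD step (IH (ltnW ln))).
apply: le_trans (enormD _ _); rewrite le_eqVlt; apply/orP; left; apply/eqP; congr enorm.
rewrite opprD; set a := g _; set b := g _; set c := g _.
by rewrite [RHS]addrACA subrKA.
Qed.
End Path.

Section Box.
Variables (R : realType) (n : nat).
Implicit Types (w z : 'rV[R]_n.+1) (r : R).

Definition box w0 r := [set w : 'rV[R]_n.+1 | forall k, `|w 0 k - w0 0 k| < r].

Lemma box_between w0 r w w' z :
  box w0 r w -> box w0 r w' -> between w w' z -> box w0 r z.
Proof.
move=> bw bw' bz k; have [s /andP[s0 s1] ->] := bz k.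
have := bw k; have := bw' k; rewrite !ltr_norml.
move: (w 0 k) (w' 0 k) (w0 0 k) => a b c /andP[h1 h2] /andP[h3 h4].
have [->|sn] := eqVneq s 0; first by rewrite mul0r addr0 h3 h4.
have sp : 0 < s by rewrite lt0r sn.
have l1 : 0 < s * (r + (b - c)) by apply: mulr_gt0 => //; lra.
have l2 : 0 < s * (r - (b - c)) by apply: mulr_gt0 => //; lra.
have l3 : 0 <= (1 - s) * (r + (a - c)) by apply: mulr_ge0; lra.
have l4 : 0 <= (1 - s) * (r - (a - c)) by apply: mulr_ge0; lra.
apply/andP; split; lra.
Qed.

Lemma nbhs_box w0 (P : set 'rV[R]_n.+1) :
  nbhs w0 P -> exists2 r, 0 < r & box w0 r `<=` P.
Proof.
move=> /nbhs_ballP[r /= r0 rP]; exists r => // w bw; apply: rP; split => // i j.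
by rewrite (ord1 i) /ball /= distrC; exact: bw.
Qed.

Lemma box_nbhs w0 r : 0 < r -> nbhs w0 (box w0 r).
Proof.
move=> r0; apply/nbhs_ballP; exists r => //= w [_ bw] k.
by have := bw 0 k; rewrite /ball /= distrC.
Qed.

Lemma near_line w v (P : set 'rV[R]_n.+1) :
  nbhs w P -> \forall s \near (0 : R), P (w + s *: v).
Proof.
move=> /nbhs_box[r r0 rP].
have L0 : 0 <= \sum_k `|v 0 k| by apply: sumr_ge0.
have d0 : 0 < r / (\sum_k `|v 0 k| + 1) by rewrite divr_gt0 // ltr_wpDl.
near=> s; apply: rP => k; rewrite !mxE addrAC subrr add0r normrM.
have : `|s| < r / (\sum_k `|v 0 k| + 1) by near: s; exact: (@nbhs0_lt R R^o).
rewrite ltr_pdivlMr ?ltr_wpDl //; apply: le_lt_trans.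
by rewrite ler_wpM2l // (bigD1 k) //= -addrA lerDl addr_ge0 // sumr_ge0.
Unshelve. all: by end_near. Qed.

Definition l1dist w w' : R := \sum_k `|w' 0 k - w 0 k|.

Lemma l1dist_ge0 w w' : 0 <= l1dist w w'.
Proof. by apply: sumr_ge0 => k _; exact: normr_ge0. Qed.

Lemma l1dist_between w w' z : between w w' z -> l1dist w z <= l1dist w w'.
Proof.
move=> bz; apply: ler_sum => k _; have [s /andP[s0 s1] ->] := bz k.
by rewrite addrC addKr normrM ger0_norm // ler_piMl.
Qed.

Lemma l1dist_box w0 r w w' : box w0 r w -> box w0 r w' ->
  l1dist w w' <= n.+1%:R * (2%:R * r).
Proof.
move=> bw bw'; rewrite -[n.+1]card_ord mulr_natl -sumr_const; apply: ler_sum => k _.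
have := bw k; have := bw' k; rewrite !ltr_norml ler_norml.
by move=> /andP[h1 h2] /andP[h3 h4]; apply/andP; split; lra.
Qed.

End Box.

Section C2Map.
Variables (R : realType) (n : nat) (g : 'rV[R]_n.+1 -> E3 R) (B : set 'rV[R]_n.+1) (C : R).
Hypothesis Bconv : forall w w' z, B w -> B w' -> between w w' z -> B z.
Notation e k := (delta_mx 0 k : 'rV[R]_n.+1).
Let D k w := 'D_(e k) g w.
Hypothesis gD : forall w k, B w -> derivable g w (e k).
Hypothesis gDD : forall w k l, B w ->
  derivable (D k) w (e l) /\ enorm ('D_(e l) (D k) w) <= C.

Lemma partial_lip k w w' : B w -> B w' -> enorm (D k w' - D k w) <= C * l1dist w w'.
Proof.
move=> Bw Bw'.
have := @path_MVT R n.+1 _ id (fun l => e l) (D k) (fun _ _ _ => erefl) w w' (fun=> 0) C.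
rewrite big1 ?subr0 => [|l _]; last by rewrite scaler0.
apply=> z bz l; rewrite subr0; exact: gDD (Bconv Bw Bw' bz).
Qed.

Lemma taylor1 w w' : B w -> B w' ->
  enorm (g w' - g w - \sum_k (w' 0 k - w 0 k) *: D k w) <= C * l1dist w w' ^+ 2.
Proof.
move=> Bw Bw'; rewrite expr2 mulrA.
apply: (@path_MVT R n.+1 _ id (fun l => e l) g (fun _ _ _ => erefl)) => z bz k.
have Bz := Bconv Bw Bw' bz; split; first exact: gD.
apply: le_trans (partial_lip k Bw Bz) _; apply: ler_wpM2l (l1dist_between bz).
by apply: le_trans (gDD k k Bw).2; exact: enorm_ge0.
Qed.

(** Linearity in the direction is recovered from the Taylor bound. It is what turns the immersion
    condition, stated for every direction, into independence of the two partial derivatives. *)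
Lemma derive_lin w v : nbhs w B -> 'D_v g w = \sum_k v 0 k *: D k w.
Proof.
move=> nB; have Bw := nbhs_singleton nB.
have [r r0 rB] := nbhs_box nB.
set S := \sum_k _.
suff key : (fun h : R => h^-1 *: ((g \o shift w) (h *: v) - g w)) @ 0^' --> S.
  exact: cvg_lim key.
apply/cvgrPdist_le => eps eps0.
pose L := \sum_k `|v 0 k|; have L0 : 0 <= L by apply: sumr_ge0.
have C0 : 0 <= C by apply: le_trans (gDD ord0 ord0 Bw).2; exact: enorm_ge0.
have d1 : 0 < r / (L + 1) by rewrite divr_gt0 // ltr_wpDl.
have d2 : 0 < eps / (C * L ^+ 2 + 1) by rewrite divr_gt0 // ltr_wpDl // mulr_ge0 ?sqr_ge0.
near=> h.
have h0 : h != 0 by near: h; exact: nbhs_dnbhs_neq.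
have h1 : `|h| < r / (L + 1) by near: h; exact: dnbhs0_lt.
have h2 : `|h| < eps / (C * L ^+ 2 + 1) by near: h; exact: dnbhs0_lt.
have Bh : B (h *: v + w).
  apply: rB => k; rewrite !mxE addrK normrM.
  rewrite ltr_pdivlMr ?ltr_wpDl // in h1; apply: le_lt_trans h1.
  by rewrite ler_wpM2l // /L (bigD1 k) //= -addrA lerDl addr_ge0 // sumr_ge0.
have lh : l1dist w (h *: v + w) = `|h| * L.
  by rewrite /l1dist /L mulr_sumr; apply: eq_bigr => k _; rewrite !mxE addrK normrM.
have -> : S - h^-1 *: ((g \o shift w) (h *: v) - g w) =
    - (h^-1 *: (g (h *: v + w) - g w - \sum_k ((h *: v + w) 0 k - w 0 k) *: D k w)).
  rewrite (_ : \sum_k _ = h *: S) /=; last first.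
    by rewrite scaler_sumr; apply: eq_bigr => k _; rewrite !mxE addrK scalerA.
  by rewrite [in RHS]scalerBr scalerA mulVf // scale1r opprB.
rewrite normrN; apply: le_trans (norm_le_enorm _) _; rewrite enormZ.
apply: le_trans (ler_wpM2l (normr_ge0 _) (taylor1 Bw Bh)) _.
have hn : `|h| != 0 by rewrite normr_eq0.
have alg (a l : R) : a != 0 -> a^-1 * (C * (a * l) ^+ 2) = a * (C * l ^+ 2) by move=> a0; field.
rewrite lh normfV alg //.
rewrite ltr_pdivlMr ?ltr_wpDl ?mulr_ge0 ?sqr_ge0 // in h2.
by apply: le_trans (ltW h2); rewrite ler_wpM2l // lerDl.
Unshelve. all: by end_near. Qed.

End C2Map.

(** * Tangential estimate in a chart *)

Section Surface.
Variable R : realType.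
Implicit Types (A : set (E3 R)).

Lemma normal_derive A (phi : E2 R -> E3 R) W w v nv : open W -> W w ->
  (forall w, W w -> A (phi w)) -> derivable phi w v -> normal_at A (phi w) nv ->
  dotp ('D_v phi w) nv = 0.
Proof.
move=> oW Ww WA dphi hn; pose c (s : R) := phi (w + s *: v).
have c0 : c 0 = phi w by rewrite /c scale0r addr0.
have eqq : (fun h : R => h^-1 *: ((c \o shift 0) (h *: 1) - c 0)) =
    (fun h : R => h^-1 *: ((phi \o shift w) (h *: v) - phi w)).
  apply/funext => h; rewrite c0 /c /= addr0; congr (_ *: (phi _ - _)).
  by rewrite addrC; congr (_ *: _ + _); exact: mulr1.
have dc : 'D_1 c 0 = 'D_v phi w by rewrite /derive eqq.
have nW : nbhs w W by apply: open_nbhs_nbhs; split.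
have Ac : \forall s \near (0 : R), A (c s) by apply: filterS (near_line v nW) => s; exact: WA.
have dc0 : derivable c 0 1 by rewrite /derivable eqq.
rewrite -dc.
exact: (hn c c0 Ac dc0).
Qed.

(** Crossing [u a + v b] with [a] or with [b] isolates one coefficient. *)
Lemma comb2_lower (a b : E3 R) (u v : R) :
  (`|u| + `|v|) * enorm (cross a b) <= enorm (u *: a + v *: b) * (enorm a + enorm b).
Proof.
rewrite mulrDl mulrDr addrC; apply: lerD; rewrite -enormZ.
  by rewrite -(cross_combr a b u v) mulrC enorm_cross_le.
by rewrite -(cross_combl a b u v) enorm_cross_le.
Qed.

Lemma near_enorm_bound (T : topologicalType) (I : finType) (w0 : T) (f : I -> I -> T -> E3 R) :
  (forall k l, {for w0, continuous (f k l)}) ->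
  exists2 C, 0 < C & \forall w \near w0, forall k l, enorm (f k l w) <= C.
Proof.
move=> cf; pose c k l := enorm (f k l w0) + 1.
have c0 k l : 0 < c k l by rewrite ltr_wpDl ?enorm_ge0.
have lt1 k l : enorm (f k l w0) < c k l by rewrite ltrDl.
clearbody c.
exists (\sum_k \sum_l c k l + 1).
  by rewrite ltr_wpDl // sumr_ge0 // => k _; apply: sumr_ge0 => l _; exact: ltW.
apply: filter_forall => k; apply: filter_forall => l.
have hc : enorm (f k l w) @[w --> w0] --> enorm (f k l w0).
  exact: (cvg_comp _ _ (cf k l) (@continuous_enorm R (f k l w0))).
apply: filterS (cvgr_le _ hc _ (lt1 k l)) => w le1; apply: le_trans le1 _.
rewrite (bigD1 k) //= (bigD1 l) //= -!addrA lerDl !addr_ge0 ?sumr_ge0 //.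
  by move=> l' _; exact: ltW.
by move=> k' _; apply: sumr_ge0 => l' _; exact: ltW.
Qed.

Lemma quadratic_of_lower (C c l E : R) : 0 < C -> 0 < c -> 0 <= l -> 0 <= E ->
  c * l <= 2%:R * E -> C * l ^+ 2 <= 4%:R * C / c ^+ 2 * E ^+ 2.
Proof.
move=> C0 c0 l0 E0 le1; have cn : c != 0 by rewrite gt_eqF.
rewrite (_ : C * _ = C / c ^+ 2 * (c * l) ^+ 2); last by field.
rewrite (_ : _ / _ * E ^+ 2 = C / c ^+ 2 * (2%:R * E) ^+ 2); last by field.
apply: ler_wpM2l; first by rewrite divr_ge0 ?exprn_ge0 // ltW.
by rewrite ler_pXn2r // nnegrE mulr_ge0 // ltW.
Qed.

Lemma dotp_comb_eq0 (p q nv : E3 R) (a b : R) :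
  dotp p nv = 0 -> dotp q nv = 0 -> dotp (a *: p + b *: q) nv = 0.
Proof. by move=> hp hq; rewrite dotpDl !dotpZl hp hq !mulr0 addr0. Qed.

(** In a chart, [z - y] is a tangent vector up to [C |w' - w|^2], and the normal kills the tangent
    vector. The immersion gives [c |w' - w| <= 2 |z - y|], which turns the remainder into a multiple
    of [|z - y|^2]. *)
Lemma surface_quadratic_local A x0 : regular_surface A -> A x0 ->
  exists2 K : R, 0 < K & exists2 N : set (E3 R), nbhs x0 N &
    forall y z nv, A y -> A z -> N y -> N z -> normal_at A y nv -> enorm nv = 1 ->
      `|dotp (z - y) nv| <= K * enorm (z - y) ^+ 2.
Proof.
move=> regA Ax0; have [U [W [phi [[oU Ux0 oW] [sm homeo imm]]]]] := regA _ Ax0.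
have [_ [fW _ sW] [ginv [ginvc ginvK]]] := homeo.
have [w0 Ww0 phiw0] := sW x0 (conj Ax0 Ux0).
have {sm}[_ sm] := sm 2%N.
pose e (k : 'I_2) : E2 R := delta_mx 0 k.
pose D k w := 'D_(e k) phi w.
have dphi w k : W w -> derivable phi w (e k) by move=> Ww; exact: (sm (e k)).1.
have dD k l w : W w -> derivable (D k) w (e l).
  by move=> Ww; have [_ [_ /(_ (e l))[h _]]] := sm (e k); exact: h.
have cDD k l : {for w0, continuous ('D_(e l) (D k))}.
  by have [_ [_ /(_ (e l))[_ [h _]]]] := sm (e k); exact: h.
have [C C0 nC] := near_enorm_bound cDD.
have nW : nbhs w0 W by apply: open_nbhs_nbhs; split.
have [r1 r10 r1W] := nbhs_box (filterI nW nC).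
have Blin v : 'D_v phi w0 = \sum_k v 0 k *: D k w0.
  apply: (@derive_lin R 1 phi (box w0 r1) C) => //; last exact: box_nbhs.
  - by move=> w w' z; exact: box_between.
  - by move=> w k bw; have [Ww _] := r1W _ bw; exact: dphi.
  - by move=> w k l bw; have [Ww h2] := r1W _ bw; split; [exact: dD | exact: h2].
pose a := D 0 w0; pose b := D 1 w0.
have sum2 (v : E2 R) (F : 'I_2 -> E3 R) : \sum_k v 0 k *: F k = v 0 0 *: F 0 + v 0 1 *: F 1.
  rewrite !big_ord_recl big_ord0 addr0.
  by congr (_ + v 0 _ *: F _); exact/val_inj.
have X0 : 0 < enorm (cross a b).
  apply: indep_cross => u v uv; pose vv : E2 R := \row_k if k == 0 then u else v.
  have [vv0|vv0] := eqVneq vv 0; last first.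
    have := imm w0 vv Ww0 vv0; rewrite Blin sum2 !mxE /= uv eqxx //.
  by move/rowP: vv0 => vv0; move: (vv0 0) (vv0 1); rewrite !mxE.
have ab0 : 0 < enorm a + enorm b.
  rewrite lt0r addr_ge0 ?enorm_ge0 // andbT; apply/eqP => ab.
  have := comb2_lower a b 1 1; rewrite ab mulr0 normr1; clear -X0; lra.
pose c := enorm (cross a b) / (enorm a + enorm b).
have c0 : 0 < c by rewrite divr_gt0.
have lower (v : E2 R) : c * (`|v 0 0| + `|v 0 1|) <= enorm (\sum_k v 0 k *: D k w0).
  rewrite sum2 /c mulrAC ler_pdivrMr // mulrC; exact: comb2_lower.
(* In the lower bound [L], the Taylor remainder costs [4 C r] and the change of the partial
   derivatives from [w0] to [w] costs [2 C r]; the total [6 C r] must be at most [c / 2]. *)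
pose r := Num.min r1 (c / (12%:R * C)).
have r0 : 0 < r by rewrite lt_min r10 divr_gt0 // mulr_gt0.
have rr1 : box w0 r `<=` box w0 r1.
  by move=> w bw k; apply: lt_le_trans (bw k) _; rewrite ge_min lexx.
have rc : 12%:R * C * r <= c.
  have : r <= c / (12%:R * C) by rewrite /r ge_min lexx orbT.
  by rewrite ler_pdivlMr ?mulr_gt0 // mulrC.
have brD w k : box w0 r w -> derivable phi w (e k) by move=> bw; have [Ww _] := r1W _ (rr1 _ bw); exact: dphi.
have brDD w k l : box w0 r w -> derivable (D k) w (e l) /\ enorm ('D_(e l) (D k) w) <= C.
  by move=> bw; have [Ww h2] := r1W _ (rr1 _ bw); split; [exact: dD | exact: h2].
have bconv : forall w w' z, box w0 r w -> box w0 r w' -> between w w' z -> box w0 r z.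
  by move=> w w' z; exact: box_between.
have T w w' : box w0 r w -> box w0 r w' ->
    enorm (phi w' - phi w - \sum_k (w' 0 k - w 0 k) *: D k w) <= C * l1dist w w' ^+ 2.
  by move=> bw bw'; exact: (@taylor1 R 1 phi (box w0 r)).
have L w w' : box w0 r w -> box w0 r w' -> c * l1dist w w' <= 2%:R * enorm (phi w' - phi w).
  move=> bw bw'.
  have bw0 : box w0 r w0 by move=> k; rewrite subrr normr0.
  have l0 := l1dist_ge0 w w'.
  have l1 : l1dist w w' <= 4%:R * r.
    by have := l1dist_box bw bw'; rewrite mulrA -natrM.
  have l2 : l1dist w0 w <= 2%:R * r.
    have -> : l1dist w0 w = `|w 0 0 - w0 0 0| + `|w 0 1 - w0 0 1|.
      rewrite /l1dist !big_ord_recl big_ord0 addr0.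
      by congr (_ + `|w 0 _ - w0 0 _|); exact/val_inj.
    have := bw 0; have := bw 1; clear; lra.
  have h1 : c * l1dist w w' <= enorm (\sum_k (w' 0 k - w 0 k) *: D k w0).
    have := lower (w' - w); rewrite !mxE.
    rewrite (eq_bigr (fun k => (w' 0 k - w 0 k) *: D k w0)); last by move=> k _; rewrite !mxE.
    rewrite (_ : l1dist w w' = `|w' 0 0 - w 0 0| + `|w' 0 1 - w 0 1|) //.
    rewrite /l1dist !big_ord_recl big_ord0 addr0.
    by congr (_ + `|w' 0 _ - w 0 _|); exact/val_inj.
  have h2 : enorm (\sum_k (w' 0 k - w 0 k) *: (D k w - D k w0)) <= C * (2%:R * r) * l1dist w w'.
    apply: le_trans (enorm_sum _ _) _; rewrite /l1dist mulr_sumr; apply: ler_sum => k _.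
    rewrite enormZ [leLHS]mulrC; apply: ler_wpM2r => //.
    apply: le_trans (@partial_lip R 1 phi (box w0 r) C bconv brDD k w0 w bw0 bw) _.
    by rewrite ler_pM2l.
  have h3 := T w w' bw bw'.
  have h4 : C * l1dist w w' ^+ 2 <= C * (4%:R * r) * l1dist w w'.
    by rewrite expr2 [leLHS]mulrA; apply: ler_wpM2r => //; rewrite ler_pM2l.
  have h5 : enorm (\sum_k (w' 0 k - w 0 k) *: D k w0) <=
     enorm (phi w' - phi w) + C * (4%:R * r) * l1dist w w' + C * (2%:R * r) * l1dist w w'.
    have -> : \sum_k (w' 0 k - w 0 k) *: D k w0 = (phi w' - phi w)
      - (phi w' - phi w - \sum_k (w' 0 k - w 0 k) *: D k w)
      - \sum_k (w' 0 k - w 0 k) *: (D k w - D k w0).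
      rewrite subKr -sumrB; apply: eq_bigr => k _.
      by rewrite scalerBr subKr.
    apply: le_trans (enormD _ _) _; rewrite enormN; apply: lerD => //.
    apply: le_trans (enormD _ _) _; rewrite enormN; apply: lerD => //.
    exact: le_trans h3 h4.
  have h6 : 12%:R * C * r * l1dist w w' <= c * l1dist w w' by rewrite ler_wpM2r.
  have := le_trans h1 h5; move: h6; clear; lra.
exists (4%:R * C / c ^+ 2); first by apply: divr_gt0; [exact: mulr_gt0 | exact: exprn_gt0].
(* Continuity of the inverse chart: points of [A] near [x0] in space have parameters near [w0], so
   no other sheet of the surface interferes. *)
have cont : \forall z \near x0, A z -> U z -> box w0 r (ginv z).
  have := (subspace_continuousP (A `&` U) ginv).1 ginvc x0 (conj Ax0 Ux0).
  have -> : ginv x0 = w0 by rewrite -phiw0 ginvK.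
  move=> /(_ _ (box_nbhs w0 r0)) h.
  have h1 : nbhs x0 [set z | (A `&` U) z -> box w0 r (ginv z)] := h.
  apply: (@filterS _ _ (nbhs_filter x0) _ _ _ h1) => z h2 Az Uz.
  exact: (h2 (conj Az Uz)).
have nU : nbhs x0 U by apply: open_nbhs_nbhs; split.
exists [set z | U z /\ (A z -> U z -> box w0 r (ginv z))].
  exact: filterI nU cont.
move=> y z nv Ay Az [Uy hy] [Uz hz] ny nv1.
have [w Ww wy] := sW y (conj Ay Uy); have [w' Ww' wz] := sW z (conj Az Uz).
have bw : box w0 r w by have := hy Ay Uy; rewrite -wy ginvK.
have bw' : box w0 r w' by have := hz Az Uz; rewrite -wz ginvK.
rewrite -wy -wz in ny *.
have WA w1 : W w1 -> A (phi w1) by move=> /fW[].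
have nD k : dotp (D k w) nv = 0.
  exact: (normal_derive oW Ww WA (dphi w k Ww) ny).
have sum0 : dotp (\sum_k (w' 0 k - w 0 k) *: D k w) nv = 0.
  rewrite (eq_bigr (fun k => (w' - w) 0 k *: D k w)); last by move=> k _; rewrite !mxE.
  rewrite (sum2 (w' - w) (fun k => D k w)).
  exact: dotp_comb_eq0 (nD 0) (nD 1).
have E1 : `|dotp (phi w' - phi w) nv| <= C * l1dist w w' ^+ 2.
  rewrite -[dotp _ _]subr0 -sum0 -dotpNl -dotpDl.
  apply: le_trans (dotp_le _ _) _; rewrite nv1 mulr1; exact: T.
apply: le_trans E1 _.
exact: (quadratic_of_lower C0 c0 (l1dist_ge0 w w') (enorm_ge0 _) (L _ _ bw bw')).
Qed.

End Surface.

(** * From local to global constants *)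

Section Compactness.
Variable R : realType.

(** Compactness as a near covering for the filter [K -> +oo]. The local statements must survive an
    increase of [K], so that one constant serves all points. *)
Lemma compact_uniform (T : topologicalType) (A : set T) (P : R -> T -> Prop) :
  compact A ->
  (forall x, A x -> exists K0, exists2 N, nbhs x N &
     forall K y, K0 <= K -> N y -> A y -> P K y) ->
  exists2 K, 0 < K & forall y, A y -> P K y.
Proof.
move=> /compact_near_coveringP cA hloc.
have := cA R (pinfty_nbhs R) (fun K y => A y -> P K y) _.
move=> /(_ _)[].
- move=> x /hloc[K0 [N nN hN]].
  exists (N, [set K | K0 <= K]) => /=.
    by split => //; exact: nbhs_pinfty_ge (num_real K0).
  by move=> [y K] /= [Ny K0K] Ay; exact: hN.
- move=> M [Mr hM]; exists (Num.max M 0 + 1).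
    by rewrite (@le_lt_trans _ _ (Num.max M 0)) ?ltrDl // le_max lexx orbT.
  move=> y Ay; apply: (hM _ _ y Ay Ay).
  by rewrite (@le_lt_trans _ _ (Num.max M 0)) ?ltrDl // le_max lexx.
Qed.

Lemma ball_enorm (x y : E3 R) r : ~ ball x r y -> r <= enorm (x - y).
Proof.
move=> nb; rewrite leNgt; apply/negP => lt; apply: nb.
by rewrite -ball_normE /=; apply: le_lt_trans lt; exact: norm_le_enorm.
Qed.

(** For close pairs the local estimate applies. For pairs at distance at least [r / 2],
    Cauchy-Schwarz suffices because [|z - y| <= (2 / r) |z - y|^2]. *)
Lemma surface_quadratic (A : set (E3 R)) : compact A -> regular_surface A ->
  exists2 K : R, 0 < K & forall y, A y -> forall z nv, A z ->
    normal_at A y nv -> enorm nv = 1 ->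
    `|dotp (z - y) nv| <= K * enorm (z - y) ^+ 2.
Proof.
move=> cA regA; apply: compact_uniform cA _ => x Ax.
have [K0 K00 [N nN hN]] := surface_quadratic_local regA Ax.
have /nbhs_ballP[r /= r0 rN] := nN.
have r20 : 0 < r / 2%:R by rewrite divr_gt0.
exists (K0 + (r / 2%:R)^-1); exists (ball x (r / 2%:R)).
  by apply/nbhs_ballP; exists (r / 2%:R).
move=> K y lK by2 Ay z nv Az ny nv1.
have lK1 : K0 <= K by apply: le_trans lK; rewrite lerDl invr_ge0 ltW.
have lK2 : (r / 2%:R)^-1 <= K by apply: le_trans lK; rewrite lerDr ltW.
have [Nz|nNz] := pselect (ball x r z).
  apply: le_trans (hN y z nv Ay Az _ (rN _ Nz) ny nv1) _.
    by apply: rN; apply: le_ball by2; rewrite ler_pdivrMr // ler_peMr ?ler1n // ltW.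
  by rewrite ler_wpM2r // exprn_ge0 // enorm_ge0.
have : r / 2%:R <= enorm (y - z).
  by apply: ball_enorm => yz; apply: nNz; rewrite [r]splitr; exact: ball_triangle by2 yz.
rewrite enormB => lz.
apply: le_trans (dotp_le _ _) _; rewrite nv1 mulr1 expr2 mulrA.
rewrite ler_peMl ?enorm_ge0 //.
rewrite -(mulVf (lt0r_neq0 r20)); apply: ler_pM => //; last exact: ltW.
by rewrite invr_ge0 ltW.
Qed.

End Compactness.

(** * Bi-Lipschitz bounds for the flow *)

Section Velocity.
Variables (R : realType) (S : evolving_surface R).

Lemma gamma0E : Gamma S 0 = Gamma0 S.
Proof.
rewrite /Gamma; apply/seteqP; split => [_ [X GX <-]|X GX].
  by rewrite Phi_init.
by exists X => //; exact: Phi_init.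
Qed.

Lemma Tend_ge0 : (0 : R) <= 0 <= Tend S.
Proof. by rewrite lexx ltW // Tend_gt0. Qed.

Lemma within_continuous_ext (V W : topologicalType) (A : set V) (f g : V -> W) x U :
  open U -> U x -> A x -> (forall y, A y -> U y -> g y = f y) ->
  {for x, continuous g} -> f @ within A (nbhs x) --> f x.
Proof.
move=> oU Ux Ax gf cg.
have nU : nbhs x U by apply: open_nbhs_nbhs; split.
move=> P; rewrite -(gf x Ax Ux) => /cg nP.
have nP' : nbhs x (g @^-1` P) := nP.
change (nbhs x [set y | A y -> P (f y)]).
apply: (@filterS _ _ (nbhs_filter x) _ _ _ (filterI nU nP')) => y [Uy Py] Ay.
by rewrite -(gf y Ay Uy).
Qed.

Lemma compact_spacetime : compact (spacetime S).
Proof.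
pose B := Gamma0 S `*` [set t | 0 <= t <= Tend S].
have -> : spacetime S = (fun z : E3 R * R => (Phi S z.1 z.2, z.2)) @` B.
  apply/seteqP; split => [[y t] [/= t01 [X GX <-]]|_ [[X t] [/= GX t01] <-]].
    by exists (X, t).
  by split => //=; exists X.
apply: continuous_compact; last first.
  apply: compact_setX; first by have [] := Gamma0_surface S.
  have -> : [set t | 0 <= t <= Tend S] = `[0, Tend S]%classic.
    by apply/seteqP; split => t /=; rewrite in_itv.
  exact: segment_compact.
apply/subspace_continuousP => -[X t] [/= GX t01].
have [U [F [oU Uz sF Ff]]] := Phi_smooth (conj GX t01 :
  [set z : E3 R * R | Gamma0 S z.1 /\ 0 <= z.2 <= Tend S] (X, t)).
have h1 : (fun z : E3 R * R => Phi S z.1 z.2) @ within B (nbhs (X, t)) --> Phi S X t.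
  apply: (@within_continuous_ext _ _ B (fun z : E3 R * R => Phi S z.1 z.2) F (X, t) U) => //.
  by have [+ _] := sF 0%N; apply.
have h : {for (X, t), continuous (snd : E3 R * R -> R)} by exact: cvg_snd.
have h2 : (snd : E3 R * R -> R) @ within B (nbhs (X, t)) --> t.
  by apply: (@within_continuous_ext _ _ B snd snd (X, t) setT) => //; exact: openT.
exact: (cvg_pair h1 h2).
Qed.

Lemma velocity_bounded : exists2 K : R, 0 < K &
  forall z, spacetime S z -> enorm (vel S z.1 z.2) <= K.
Proof.
apply: compact_uniform compact_spacetime _ => z Sz.
have [U [F [oU Uz [cF _] Ff]]] := vel_C1 Sz.
have hc : enorm (F w) @[w --> z] --> enorm (F z).
  exact: (cvg_comp _ _ (cF z Uz) (@continuous_enorm R (F z))).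
have lt1 : enorm (F z) < enorm (F z) + 1 by rewrite ltrDl.
have h : nbhs z [set w | enorm (F w) <= enorm (F z) + 1].
  exact: (@cvgr_le R _ (nbhs z) (nbhs_filter z) _ _ hc _ lt1).
have nU : nbhs z U by apply: open_nbhs_nbhs; split.
exists (enorm (F z) + 1); exists (U `&` [set w | enorm (F w) <= enorm (F z) + 1]).
  exact: (@filterI _ _ (nbhs_filter z) _ _ nU h).
by move=> K y lK [Uy Fy] Sy; rewrite -(Ff _ Sy Uy); exact: le_trans lK.
Qed.

(** A coordinate path between two points leaves the surface, so for close points the estimate is
    made on a local [C^1] extension in a space-time ball; summing three coordinates gives [3 C]. For
    distant points the difference is at most [2 V], and the distance is at least [r / 2]. *)
Lemma velocity_lipschitz : exists2 L : R, 0 < L & forall z, spacetime S z ->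
  forall y, spacetime S (y, z.2) ->
    enorm (vel S z.1 z.2 - vel S y z.2) <= L * enorm (z.1 - y).
Proof.
have [V V0 hV] := velocity_bounded.
apply: compact_uniform compact_spacetime _ => z0 Sz0.
have [U [F [oU Uz [cF dF] Ff]]] := vel_C1 Sz0.
pose e (k : 'I_3) : E3 R * R := (delta_mx 0 k, 0).
have cD (k l : 'I_3) : {for z0, continuous ('D_(e k) F)}.
  by have [_ [h _]] := dF (e k); exact: h.
have [C C0 nC] := near_enorm_bound cD.
have nU : nbhs z0 U by apply: open_nbhs_nbhs; split.
have /nbhs_ballP[r /= r0 rN] := @filterI _ _ (nbhs_filter z0) _ _ nU nC.
have r20 : 0 < r / 2%:R by rewrite divr_gt0.
exists (3%:R * C + (r / 2%:R)^-1 * (2%:R * V)); exists (ball z0 (r / 2%:R)).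
  by apply/nbhs_ballP; exists (r / 2%:R).
move=> L z lL bz Sz y Sy.
have LC : 3%:R * C <= L.
  by apply: le_trans lL; rewrite lerDl mulr_ge0 ?invr_ge0 ?mulr_ge0 // ltW.
have LV : (r / 2%:R)^-1 * (2%:R * V) <= L.
  by apply: le_trans lL; rewrite lerDr mulr_ge0 // ltW.
case: z bz Sz Sy => x t bz Sz /= Sy; have bz' : ball z0 r (x, t).
  by apply: le_ball bz; rewrite ler_pdivrMr // ler_peMr ?ler1n // ltW.
have [by_|nby] := pselect (ball z0 r (y, t)); last first.
  have ly : r / 2%:R <= enorm (x - y).
    apply: ball_enorm => xy; apply: nby; rewrite [r]splitr.
    by apply: ball_triangle bz _; split => //=; exact: ballxx.
  have l2 : enorm (vel S x t - vel S y t) <= 2%:R * V.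
    apply: le_trans (enormD _ _) _; rewrite enormN mulr_natl mulr2n.
    exact: lerD (hV _ Sz) (hV _ Sy).
  apply: le_trans l2 _; apply: le_trans (ler_wpM2r (enorm_ge0 _) LV).
  rewrite mulrAC -[leLHS]mul1r; apply: ler_wpM2r; first by rewrite mulr_ge0 // ltW.
  by rewrite ler_pdivlMl // mulr1.
have UE w s : spacetime S (w, s) -> ball z0 r (w, s) -> vel S w s = F (w, s).
  by move=> Sw bw; rewrite (Ff _ Sw (rN _ bw).1).
rewrite (UE _ _ Sz bz') (UE _ _ Sy by_) enormB.
have injD (w : 'rV[R]_3) s k : (w + s *: delta_mx 0 k, t) = (w, t) + s *: e k.
  by congr pair; rewrite /= scaler0 addr0.
have key : enorm (F (y, t) - F (x, t)) <= C * \sum_k `|y 0 k - x 0 k|.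
  have := @path_MVT R 3 _ (fun w => (w, t)) e F injD x y (fun=> 0) C.
  rewrite big1 ?subr0 => [|l _]; last by rewrite scaler0.
  apply=> z bxz k.
  have bzz : ball z0 r (z, t).
    split => /=; last by case: bz'.
    case: bz' => -[/= _ bx] _; case: by_ => -[/= _ by'] _.
    split => // i j; rewrite (ord1 i).
    have := @box_between R 2 z0.1 r x y z _ _ bxz j.
    rewrite /ball /= distrC; apply => l.
      by rewrite distrC; exact: bx.
    by rewrite distrC; exact: by'.
  rewrite subr0; split; first by have [h _] := dF (e k); exact: h (rN _ bzz).1.
  exact: ((rN _ bzz).2 k k).
apply: le_trans key _; apply: le_trans (ler_wpM2r (enorm_ge0 _) LC).
rewrite mulrAC [leRHS]mulrC; apply: ler_wpM2l; first exact: ltW.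
have -> : 3%:R * enorm (x - y) = \sum_(k < 3) enorm (x - y).
  by rewrite sumr_const card_ord mulr_natl.
apply: ler_sum => k _.
by rewrite enormB; have := enorm_coord (y - x) k; rewrite !mxE.
Qed.

End Velocity.

Section Flow.
Variables (R : realType) (S : evolving_surface R).

Lemma flow_derive X t k : Gamma0 S X -> 0 < t < Tend S ->
  is_derive t 1 (fun s : R => Phi S X s 0 k) (vel S (Phi S X t) t 0 k).
Proof.
move=> GX /andP[t0 tT].
have tT' : 0 <= t <= Tend S by rewrite !ltW.
have flow := Phi_flow GX tT'.
have key : (fun h : R => h^-1 *: (((fun s : R => Phi S X s 0 k) \o shift t) (h *: 1) -
    Phi S X t 0 k)) @ 0^' --> vel S (Phi S X t) t 0 k.
  move=> P nP.
  have nP' : nbhs (vel S (Phi S X t) t) [set z : E3 R | P (z 0 k)].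
    exact: (@coord_continuous R 1 3 0 k (vel S (Phi S X t) t) P nP).
  have h1 : nbhs t [set s | s != t -> 0 <= s <= Tend S ->
      P (((s - t)^-1 *: (Phi S X s - Phi S X t)) 0 k)] := flow _ nP'.
  have /nbhs_ballP[r /= r0 rP] := h1.
  change (nbhs (0 : R) [set h | h != 0 ->
    P (h^-1 *: (Phi S X (h *: (1 : R) + t) 0 k - Phi S X t 0 k))]).
  apply/nbhs_ballP; exists (Num.min r (Num.min t (Tend S - t))) => /=.
    by rewrite !lt_min r0 t0 subr_gt0.
  move=> h; rewrite /ball /= sub0r normrN !lt_min => /and3P[hr ht hT] h0.
  have -> : h *: (1 : R) = h by exact: mulr1.
  have /(_ _ _) := rP (h + t); rewrite /ball /= opprD addrCA subrr addr0 normrN.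
  move=> /(_ hr); rewrite addrK !mxE; apply.
    by rewrite -subr_eq0 addrK.
  by move: ht hT; rewrite !ltr_norml => /andP[? ?] /andP[? ?]; apply/andP; split; lra.
apply: DeriveDef; first by apply/cvg_ex; exists (vel S (Phi S X t) t 0 k).
exact: cvg_lim key.
Qed.

(** [flow_derive] covers the open time interval; the mean value theorem also needs continuity up to
    the end points. *)
Lemma flow_within X t : Gamma0 S X -> 0 <= t <= Tend S ->
  (fun s : R => Phi S X s) @ within `[0, Tend S] (nbhs t) --> Phi S X t.
Proof.
move=> GX t01.
have [U [F [oU Uz sF Ff]]] := Phi_smooth (conj GX t01 :
  [set z : E3 R * R | Gamma0 S z.1 /\ 0 <= z.2 <= Tend S] (X, t)).
have cX : continuous (fun s : R => (X, s) : E3 R * R).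
  by move=> s; exact: (cvg_pair (cvg_cst X) cvg_id).
have cF : {for (X, t), continuous F} by have [+ _] := sF 0%N; apply.
apply: (@within_continuous_ext _ _ `[0, Tend S]%classic (fun s => Phi S X s)
  (fun s => F (X, s)) t [set s | U (X, s)]) => //.
- by apply: open_comp oU => s _; exact: cX.
- by move=> s s01 Us; rewrite Ff //=; split=> //; rewrite /= in_itv in s01.
- exact: (continuous_comp (cX t) cF).
Qed.

Section Pair.
Variables X Y : E3 R.
Hypotheses (GX : Gamma0 S X) (GY : Gamma0 S Y).
Let D t := Phi S X t - Phi S Y t.
Let V t := vel S (Phi S X t) t - vel S (Phi S Y t) t.

(** The exponential is Gronwall's integrating factor; [a] will be [- 2 L] and [2 L]. *)
Lemma flow_pair_derive a t : 0 < t < Tend S ->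
  is_derive t 1 (fun s : R => expR (a * s) * dotp (D s) (D s))
    (expR (a * t) * (a * dotp (D t) (D t) + 2%:R * dotp (D t) (V t))).
Proof.
move=> t01; pose c k (s : R) := Phi S X s 0 k - Phi S Y s 0 k.
have dc k : is_derive t 1 (c k) (V t 0 k).
  have d1 := flow_derive k GX t01; have d2 := flow_derive k GY t01.
  by rewrite /V !mxE; exact: is_deriveB.
have da : is_derive t 1 (fun s : R => expR (a * s)) (expR (a * t) * a).
  have dm : is_derive t 1 (fun s : R => a * s) a.
    by apply: is_derive_eq; rewrite ?scaler0 ?addr0 ?add0r; exact: mulr1.
  exact: (@is_derive1_comp R expR (fun s => a * s) t _ _ (is_derive_expR _) dm).
have := dc 0; have := dc 1; have := dc 2%:R => d2 d1 d0.
have -> : (fun s : R => expR (a * s) * dotp (D s) (D s)) =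
    (fun s => expR (a * s)) * (c 0 * c 0 + c 1 * c 1 + c 2%:R * c 2%:R).
  by apply/funext => s; rewrite dotpE /D !mxE.
have dg := is_deriveD (is_deriveD (is_deriveM d0 d0) (is_deriveM d1 d1)) (is_deriveM d2 d2).
apply: (is_derive_eq (is_deriveM da dg)); rewrite !dotpE /D !mxE -![Phi S X t 0 _ - _]/(c _ t).
rewrite -[(c 0 * _ + _ + _) t]/(c 0 t * c 0 t + c 1 t * c 1 t + c 2%:R t * c 2%:R t).
rewrite /GRing.scale /=; ring.
Qed.

Lemma flow_pair_MVT a t : 0 < t <= Tend S -> exists2 s, 0 < s < Tend S &
  expR (a * t) * dotp (D t) (D t) - dotp (D 0) (D 0) =
  expR (a * s) * (a * dotp (D s) (D s) + 2%:R * dotp (D s) (V s)) * t.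
Proof.
move=> /andP[t0 tT].
have tlt s : s \in `]0, t[%R -> 0 < s < Tend S.
  by rewrite in_itv /= => /andP[-> st]; exact: lt_le_trans tT.
have df s : s \in `]0, t[%R -> is_derive s 1 (fun s : R => expR (a * s) * dotp (D s) (D s))
    (expR (a * s) * (a * dotp (D s) (D s) + 2%:R * dotp (D s) (V s))).
  by move=> /tlt; exact: flow_pair_derive.
have cf : {within `[0, t], continuous (fun s : R => expR (a * s) * dotp (D s) (D s))}.
  apply: (@continuous_subspaceW _ _ _ `[0, Tend S]%classic).
    by move=> s /=; rewrite !in_itv /= => /andP[-> st]; exact: le_trans tT.
  apply/subspace_continuousP => s; rewrite /= in_itv /= => s01.
  have cD : D @ within `[0, Tend S] (nbhs s) --> D s.
    exact: cvgB (flow_within GX s01) (flow_within GY s01).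
  have cDD : (fun r => dotp (D r) (D r)) @ within `[0, Tend S] (nbhs s) --> dotp (D s) (D s).
    exact: (cvg_comp _ _ cD (@continuous_dotpp R (D s))).
  have ce : (fun r => expR (a * r)) @ within `[0, Tend S] (nbhs s) --> expR (a * s).
    apply: cvg_within_filter; apply: continuous_comp; last exact: continuous_expR.
    exact: mulrl_continuous.
  exact: cvgM ce cDD.
have [s s01] := MVT t0 df cf.
rewrite mulr0 expR0 mul1r subr0 => ->; exists s => //; exact: tlt.
Qed.

End Pair.

(** Since [|2 D.V| <= 2 L |D|^2], the quantity [exp(- 2 L t) |D|^2] never exceeds its initial value
    and [exp(2 L t) |D|^2] never falls below it. These are the two inequalities after a square
    root. *)
Lemma flow_bilipschitz : exists2 K : R, 1 <= K & forall X Y t,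
  Gamma0 S X -> Gamma0 S Y -> 0 <= t <= Tend S ->
  enorm (Phi S X t - Phi S Y t) <= K * enorm (X - Y) /\
  enorm (X - Y) <= K * enorm (Phi S X t - Phi S Y t).
Proof.
have [L L0 hL] := velocity_lipschitz S.
have T0 := ltW (Tend_gt0 S).
have K1 : 1 <= expR (L * Tend S) by rewrite -expR0 ler_expR mulr_ge0 // ltW.
exists (expR (L * Tend S)) => // X Y t GX GY /andP[t0 tT].
have [->|tn] := eqVneq t 0.
  by rewrite !Phi_init //; split; rewrite ler_peMl ?enorm_ge0.
have t01 : 0 < t <= Tend S by rewrite lt0r tn t0.
set D := fun t => Phi S X t - Phi S Y t.
set V := fun t => vel S (Phi S X t) t - vel S (Phi S Y t) t.
have bnd s : 0 < s < Tend S -> `|2%:R * dotp (D s) (V s)| <= 2%:R * L * dotp (D s) (D s).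
  move=> /andP[s0 sT]; rewrite normrM ger0_norm // -mulrA ler_pM2l //.
  apply: le_trans (dotp_le _ _) _; rewrite -sqr_enorm expr2 mulrA mulrC.
  apply: ler_wpM2r; first exact: enorm_ge0.
  have sp Z : Gamma0 S Z -> spacetime S (Phi S Z s, s).
    by move=> GZ; split => /=; [rewrite !ltW | exists Z].
  exact: (hL _ (sp _ GX) _ (sp _ GY)).
have D0 : D 0 = X - Y by rewrite /D !Phi_init.
have eT2 : expR (2%:R * L * t) <= expR (L * Tend S) ^+ 2.
  by rewrite -expRM_natl mulrA ler_expR ler_pM2l ?mulr_gt0.
have sq (x y : E3 R) : dotp x x <= expR (L * Tend S) ^+ 2 * dotp y y ->
    enorm x <= expR (L * Tend S) * enorm y.
  rewrite -!sqr_enorm -exprMn ler_pXn2r // nnegrE ?mulr_ge0 ?enorm_ge0 // expR_ge0.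
split; apply: sq; rewrite -?D0 -/(D t).
- have [s s01] := flow_pair_MVT GX GY (- (2%:R * L)) t01; rewrite -/(D t) -/(D 0) -/(D s) -/(V s).
  have neg : - (2%:R * L) * dotp (D s) (D s) + 2%:R * dotp (D s) (V s) <= 0.
    by have /ler_normlP[_] := bnd s s01; clear; lra.
  have := mulr_ge0_le0 (expR_ge0 (- (2%:R * L) * s)) neg => h.
  have := mulr_le0_ge0 h t0 => h' e; rewrite -e subr_le0 in h'.
  apply: le_trans (ler_wpM2r (dotpp_ge0 _) eT2).
  rewrite -ler_pdivrMl ?expR_gt0 // -expRN -mulNr; exact: h'.
- have [s s01] := flow_pair_MVT GX GY (2%:R * L) t01; rewrite -/(D t) -/(D 0) -/(D s) -/(V s).
  have pos : 0 <= 2%:R * L * dotp (D s) (D s) + 2%:R * dotp (D s) (V s).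
    by have /ler_normlP[+ _] := bnd s s01; clear; lra.
  have := mulr_ge0 (mulr_ge0 (expR_ge0 (2%:R * L * s)) pos) t0 => h e; rewrite -e subr_ge0 in h.
  exact: le_trans h (ler_wpM2r (dotpp_ge0 _) eT2).
Qed.

End Flow.

(** * Comparable edge lengths in a star *)

Section Sheets.
Variables (R : realType) (gamma h : R) (e f : E3 R).
Hypotheses (g0 : 0 < gamma) (fef : fat gamma h e f).

Lemma fat_ge2 : 2%:R <= gamma.
Proof.
have h0 := fat_gt0 fef; have := fat_el g0 fef; case: fef => /andP[_ eh] _ _ _ _ le1.
by rewrite -(ler_pM2r h0); apply: le_trans le1 _; rewrite ler_pM2l.
Qed.

(** Left unnormalised, so that its coordinates on [e] and [f] stay explicit. *)
Definition bisector : E3 R := (enorm e)^-1 *: e + (enorm f)^-1 *: f.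

Lemma bisector_le2 : enorm bisector <= 2%:R.
Proof.
case: fef => /andP[e0 _] /andP[f0 _] _ _ _.
apply: le_trans (enormD _ _) _.
rewrite !enormZ !ger0_norm ?invr_ge0 ?enorm_ge0 // !mulVf ?gt_eqF //.
Qed.

Lemma fat_span q : dotp q (cross e f) = 0 -> exists u v, q = u *: e + v *: f.
Proof.
move=> qn; have [u [v [ue vf]]] := gram_solve (dotp q e) (dotp q f) (fat_cross_gt0 g0 fef).
exists u, v; apply/eqP; rewrite -subr_eq0; apply/eqP; apply: enorm_eq0.
set w := q - _.
have wn : dotp w (cross e f) = 0.
  by rewrite /w dotpDl dotpNl qn dotpDl !dotpZl dotp_crossl dotp_crossr; ring.
have := fat_plane g0 fef wn.
rewrite [dotp w e]dotpDl [dotp w f]dotpDl !dotpNl ue vf !subrr normr0 addr0 mulr0.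
have h0 := fat_gt0 fef; rewrite pmulr_rle0 ?mulr_gt0 // => w0.
by apply/eqP; rewrite eq_le w0 enorm_ge0.
Qed.

(** The coordinates of [q] differ from [s / |e|] and [s / |f|] by at most [s / (2 h)], while those
    are at least [s / h]: hence positivity. They are also at most [gamma s / (2 h)], and the bound
    on [s] then gives [u + v < 1]. *)
Lemma fat_bisector_cone s q : 0 < s -> s <= h / (2%:R * (gamma + 1)) ->
  dotp q (cross e f) = 0 -> enorm (q - s *: bisector) <= s / gamma ->
  exists u v, [/\ 0 < u, 0 < v, u + v < 1 & q = u *: e + v *: f].
Proof.
move=> s0 sh qn qs; have [u [v quv]] := fat_span qn.
have h0 := fat_gt0 fef; have el := fat_el g0 fef; have er := fat_er g0 fef.
have c0 := fat_cross_gt0 g0 fef.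
case: fef => /andP[e0 eh] /andP[f0 fh] _ le1 le2.
have qE : q - s *: bisector = (u - s / enorm e) *: e + (v - s / enorm f) *: f.
  by rewrite quv /bisector; apply: row3P; rewrite !mxE; ring.
have bnd (w a : R) : w * enorm (cross e f) <= enorm (q - s *: bisector) * a ->
    2%:R * h * a <= gamma * enorm (cross e f) -> 0 <= a -> 2%:R * h * w <= s.
  move=> wa ha a0; rewrite -(ler_pM2r c0) -[leLHS]mulrA.
  apply: le_trans (ler_wpM2l _ wa) _; first by rewrite mulr_ge0 // ltW.
  rewrite mulrCA; apply: le_trans (ler_wpM2r _ qs) _; first by rewrite !mulr_ge0 // ltW.
  by rewrite -mulrA ler_pM2l // ler_pdivrMl.
have bu : 2%:R * h * `|u - s / enorm e| <= s.
  apply: bnd le2 _; last exact: ltW.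
  by rewrite -enormZ -(cross_combl e f _ (v - s / enorm f)) -qE enorm_cross_le.
have bv : 2%:R * h * `|v - s / enorm f| <= s.
  apply: bnd le1 _; last exact: ltW.
  by rewrite -enormZ -(cross_combr e f (u - s / enorm e)) -qE mulrC enorm_cross_le.
have h2 : 0 < 2%:R * h by rewrite mulr_gt0.
have inv (l : R) : 0 < l -> l <= h -> 2%:R * h <= gamma * l ->
    2%:R * s <= 2%:R * h * (s / l) <= gamma * s.
  move=> l0 lh gl; have ln : l != 0 by rewrite gt_eqF.
  rewrite (_ : 2%:R * h * (s / l) = 2%:R * s * (h / l)); last by field.
  rewrite ler_peMr ?mulr_ge0 ?(ltW s0) ?ler_pdivlMr ?mul1r //=.
  rewrite (_ : 2%:R * s * (h / l) = 2%:R * h / l * s); last by field.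
  by rewrite ler_pM2r // ler_pdivrMr.
have /andP[iu1 iu2] := inv _ e0 eh el; have /andP[iv1 iv2] := inv _ f0 fh er.
have sg : 2%:R * ((gamma + 1) * s) <= h.
  move: sh; rewrite ler_pdivlMr; first by rewrite (mulrC s) -mulrA.
  by rewrite mulr_gt0 // addr_gt0.
have habs w : 2%:R * h * `|w| = `|2%:R * h * w| by rewrite [RHS]normrM (gtr0_norm h2).
move: bu bv; rewrite !habs !mulrBr !ler_norml.
move=> /andP[u1 u2] /andP[v1 v2].
exists u, v; split => //.
- by rewrite -(pmulr_rgt0 _ h2); lra.
- by rewrite -(pmulr_rgt0 _ h2); lra.
- by rewrite -(ltr_pM2l h2) mulr1 mulrDr; lra.
Qed.

(** The component [w] of [nv] in the plane of the triangle has the same products with [e] and [f] as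
    [nv], so [fat_plane] gives [|w| <= 1/2]; the normal component is then at least [1/2]. *)
Lemma fat_transversal K nv : enorm nv = 1 ->
  `|dotp nv e| <= K -> `|dotp nv f| <= K -> 2%:R * gamma * K <= h ->
  enorm (cross e f) <= 2%:R * `|dotp nv (cross e f)|.
Proof.
move=> nv1 ne nf gK; have h0 := fat_gt0 fef; have c0 := fat_cross_gt0 g0 fef.
set n := cross e f in c0 *.
have nn : dotp n n = enorm n ^+ 2 by rewrite sqr_enorm.
pose w := nv - (dotp nv n / enorm n ^+ 2) *: n.
have wn : dotp w n = 0.
  rewrite dotpDl dotpNl dotpZl nn divfK ?subrr //.
  by rewrite expf_neq0 // gt_eqF.
have we : dotp w e = dotp nv e.
  by rewrite dotpDl dotpNl dotpZl (dotpC n) dotp_crossl mulr0 subr0.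
have wf : dotp w f = dotp nv f.
  by rewrite dotpDl dotpNl dotpZl (dotpC n) dotp_crossr mulr0 subr0.
have := fat_plane g0 fef wn; rewrite we wf => lew.
have w2 : enorm w <= 2%:R^-1.
  rewrite -(ler_pM2l (_ : 0 < 2%:R * h)) ?mulr_gt0 //; apply: le_trans lew _.
  rewrite mulrAC mulfV ?pnatr_eq0 // mul1r; apply: le_trans gK.
  rewrite (mulrC 2%:R) -mulrA ler_pM2l // mulr_natl mulr2n; exact: lerD.
have : 1 <= enorm w + `|dotp nv n| / enorm n.
  rewrite -nv1 -[nv in leLHS](subrK ((dotp nv n / enorm n ^+ 2) *: n)).
  apply: le_trans (enormD _ _) _; rewrite lerD2l enormZ normrM normfV.
  rewrite (ger0_norm (exprn_ge0 _ (enorm_ge0 _))) expr2 invfM -!mulrA mulVf ?gt_eqF //.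
  by rewrite mulr1.
move=> le1; have : 2%:R^-1 <= `|dotp nv n| / enorm n by lra.
by rewrite ler_pdivlMr // -ler_pdivrMl ?invr_gt0 // invrK.
Qed.

End Sheets.

Lemma edist_le (R : realType) (A : set (E3 R)) x y : A y -> Defs.edist A x <= enorm (x - y).
Proof.
move=> Ay; apply: ge_inf; last by exists y.
by exists 0 => _ [z _ <-]; exact: enorm_ge0.
Qed.

Lemma sdist_le (R : realType) (A : set (E3 R)) x y : A y -> `|sdist A x| <= enorm (x - y).
Proof.
move=> Ay; have e0 : 0 <= Defs.edist A x.
  by apply: lb_le_inf; [exists (enorm (x - y)); exists y | move=> _ [z _ <-]; exact: enorm_ge0].
have -> : `|sdist A x| = Defs.edist A x.
  by rewrite /sdist; case: ifP => _; [rewrite normrN|]; rewrite ger0_norm.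
exact: edist_le.
Qed.

Lemma card_set3_neq (T : finType) (a b c : T) : #|[set a; b; c]%SET| = 3%N ->
  [/\ a != b, a != c & b != c].
Proof.
move=> h3; have lt2 (x y : T) : ~ #|[set x; y]%SET| = 3%N by rewrite cards2; case: eqP.
split; apply/eqP => E; subst.
- by apply: (lt2 b c); rewrite -h3 finset.setUid.
- by apply: (lt2 c b); rewrite -h3 -finset.setUA (finset.setUC [set b]%SET) finset.setUA finset.setUid.
- by apply: (lt2 a c); rewrite -h3 -finset.setUA finset.setUid.
Qed.

(** * Stars, projection and disjointness of triangles *)

Section MeshFacts.
Variables (R : realType) (S : evolving_surface R) (M : nat) (m : mesh R M).
Variables (gamma : R) (Nbh : R -> set (E3 R)).
Hypotheses (g0 : 0 < gamma) (hN : surface_nbhd S Nbh).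
Hypothesis hm : admissible_mesh S m gamma Nbh.

Let triang : triangulation S m. Proof. by case: hm. Qed.
Let stars : clockwise_stars S m. Proof. by case: hm. Qed.
Let reg : regular_mesh S m gamma. Proof. by case: hm. Qed.

Lemma star_tri_in i (j : 'I_(Ups m i)) : star_tri j \in tris m.
Proof.
have [_ eqs _] := stars i; have : star_tri j \in [set K in tris m | i \in K]%SET.
  by rewrite -eqs; apply/imsetP; exists j.
by rewrite inE => /andP[].
Qed.

Lemma star_tri_inj i : injective (@star_tri R M m i).
Proof.
have [_ eqs _] := stars i.
have /imset_injP inj : #|[set star_tri j | j : 'I_(Ups m i)]%SET| == #|'I_(Ups m i)|.
  by rewrite eqs card_ord /Ups /degree.
by move=> j k; exact: inj.
Qed.

Lemma star_tri_neq i (j : 'I_(Ups m i)) :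
  [/\ i != nb j, i != nb (ordS j) & nb j != nb (ordS j)].
Proof.
have [_ c3 _ _ _] := triang.
exact: card_set3_neq (c3 _ (star_tri_in j)).
Qed.

Lemma star_fat t i (j : 'I_(Ups m i)) : 0 <= t <= Tend S ->
  fat gamma (tri_diam S t j) (vtx S m t (nb j) - vtx S m t i)
    (vtx S m t (nb (ordS j)) - vtx S m t i).
Proof.
move=> t01; have [ia ib ab] := star_tri_neq j; have [_ _ _ ind _] := triang.
by apply: fat_tri => //; [apply: ind | apply: reg] => //; exact: star_tri_in.
Qed.

Lemma vtx_surface t i : 0 <= t <= Tend S -> Gamma S t (vtx S m t i).
Proof. by move=> t01; exists (x0 m i) => //; have [] := triang. Qed.

Lemma star_hull_Gammah t i (j : 'I_(Ups m i)) y :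
  hull (vtx S m t) (star_tri j) y -> Gammah S m t y.
Proof. by exists (star_tri j) => //; exact: star_tri_in. Qed.

(** [is_proj] only places [p] on a normal line at the signed distance. As [|sdist|] is the distance
    to the surface, the projection is a nearest point. *)
Lemma projP t p : 0 <= t <= Tend S -> Gammah S m t p ->
  [/\ Gamma S t (Defs.proj S t p),
      exists2 s, p = Defs.proj S t p + s *: nu S t (Defs.proj S t p) &
        forall y, Gamma S t y -> `|s| <= enorm (p - y)
    & forall y, Gamma S t y -> enorm (p - Defs.proj S t p) <= enorm (p - y)].
Proof.
move=> t01 hp; have [_ _ _ /(_ _ t01)[sub _]] := hm.
have [_ _ /(_ _ (sub _ hp))[y0 [hy0 _]]] := hN t01.
have [Gp pE] : is_proj S t p (Defs.proj S t p).
  by rewrite /Defs.proj; case: xgetP => // /(_ y0).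
have dl y : Gamma S t y -> `|sdist (Gamma S t) p| <= enorm (p - y) by exact: sdist_le.
split => //; first by exists (sdist (Gamma S t) p).
have pB : p - Defs.proj S t p = sdist (Gamma S t) p *: nu S t (Defs.proj S t p).
  by apply/eqP; rewrite subr_eq addrC; apply/eqP.
move=> y /dl; rewrite pB enormZ.
by have [-> _ _] := nu_normal t01 Gp; rewrite mulr1.
Qed.

Lemma proj_inj t p q : 0 <= t <= Tend S -> Gammah S m t p -> Gammah S m t q ->
  Defs.proj S t p = Defs.proj S t q -> p = q.
Proof.
move=> t01 hp hq; have [_ _ _ /(_ _ t01)[_ [_ [_ inj _] _]]] := hm.
by apply: inj; rewrite inE.
Qed.

(** Two triangles meet in the hull of their common vertices. Barycentric coordinates in triangle [j]
    are unique and all positive at [p], so all three vertices are common and the triangles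
    coincide. *)
Lemma hull_interior_disjoint t i (j k : 'I_(Ups m i)) u v :
  0 <= t <= Tend S -> j != k -> 0 < u -> 0 < v -> u + v < 1 ->
  let p := vtx S m t i + u *: (vtx S m t (nb j) - vtx S m t i)
    + v *: (vtx S m t (nb (ordS j)) - vtx S m t i) in
  ~ hull (vtx S m t) (star_tri k) p.
Proof.
move=> t01 jk u0 v0 uv /= hk.
have [ia ib ab] := star_tri_neq j; have [_ c3 _ ind int] := triang.
have Kj := star_tri_in j; have Kk := star_tri_in k.
set p := _ + _ in hk; set x := vtx S m t in p hk *.
have hj : hull x (star_tri j) p.
  by apply/(hull3P x ia ib ab); exists u, v; split => //; exact: ltW.
have := conj hj hk : (hull x (star_tri j) `&` hull x (star_tri k)) p.
rewrite (int _ _ _ t01 Kj Kk) => -[w [w0 ws wp]].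
pose W l := (if l \in star_tri k then w l else 0) - wt3 i (nb j) (nb (ordS j)) (1 - u - v) u v l.
have [wi wa wb] := @wt3E R M i (nb j) (nb (ordS j)) (1 - u - v) u v ia ib ab.
have sumW (V : nmodType) (F : 'I_M -> V) :
    \sum_(l in (star_tri j :&: star_tri k)%SET) F l =
    \sum_(l in star_tri j) (if l \in star_tri k then F l else 0).
  by rewrite -big_mkcondr; apply: eq_bigl => l; rewrite !inE.
have h1 : \sum_(l in star_tri j) W l = 0.
  rewrite sumrB -sumW ws (sum_set3 _ ia ib ab) wi wa wb; ring.
have h2 : \sum_(l in star_tri j) W l *: x l = 0.
  rewrite (eq_bigr (fun l => (if l \in star_tri k then w l *: x l else 0) -
      wt3 i (nb j) (nb (ordS j)) (1 - u - v) u v l *: x l)); last first.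
    by move=> l _; rewrite /W scalerBl; case: ifP => // _; rewrite scale0r.
  rewrite sumrB -sumW -wp (sum_set3 _ ia ib ab) wi wa wb /p.
  by rewrite comb3E ?subrr //; ring.
have W0 := ind _ _ t01 Kj _ h1 h2.
have sub : star_tri j \subset star_tri k.
  apply/fintype.subsetP => l lj; have := W0 l lj; rewrite /W; case: ifP => // _.
  rewrite sub0r => /eqP; rewrite oppr_eq0 => /eqP.
  move: lj; rewrite !inE => /orP[/orP[]|] /eqP ->; rewrite ?wi ?wa ?wb; lra.
have : star_tri j = star_tri k.
  by apply/eqP; rewrite eqEcard sub (c3 _ Kj) (c3 _ Kk).
by move/star_tri_inj => E; rewrite E eqxx in jk.
Qed.

End MeshFacts.

(** Expanding the squares gives [|d|^2 <= 2 r (d.nv) <= 6 K s |d|^2 <= |d|^2 / 2]. Geometrically, a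
    short normal segment has its foot as the only nearest point of the surface. *)
Lemma normal_line_nearest (R : realType) (nv d : E3 R) (r K s : R) :
  enorm nv = 1 -> `|r| <= 3%:R * s -> 12%:R * (K * s) <= 1 ->
  `|dotp d nv| <= K * enorm d ^+ 2 -> enorm (r *: nv - d) <= enorm (r *: nv) -> d = 0.
Proof.
move=> nv1 rs sK q1 le1; apply: dotpp_eq0.
have nn : dotp nv nv = 1 by rewrite -sqr_enorm nv1 expr1n.
have : enorm (r *: nv - d) ^+ 2 <= enorm (r *: nv) ^+ 2.
  by rewrite ler_pXn2r // nnegrE enorm_ge0.
rewrite !sqr_enorm !dotpl (dotpC nv d) nn => le2; rewrite sqr_enorm in q1.
have dd := dotpp_ge0 d.
have le3 : `|r * dotp d nv| <= 3%:R * s * (K * dotp d d).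
  by rewrite normrM; apply: ler_pM.
have le4 : dotp d d <= 2%:R * `|r * dotp d nv|.
  have := ler_norm (r * dotp d nv); lra.
have le5 : 12%:R * (K * s) * dotp d d <= dotp d d by rewrite ler_piMl.
lra.
Qed.

Section TwoSheets.
Variables (R : realType) (S : evolving_surface R) (M : nat) (m : mesh R M).
Variables (gamma : R) (Nbh : R -> set (E3 R)).
Hypotheses (g0 : 0 < gamma) (hN : surface_nbhd S Nbh).
Hypothesis hm : admissible_mesh S m gamma Nbh.
Variables (t K : R).
Hypotheses (t01 : 0 <= t <= Tend S) (K0 : 0 < K).
Hypothesis quad : forall y z, Gamma S t y -> Gamma S t z ->
  `|dotp (z - y) (nu S t y)| <= K * enorm (z - y) ^+ 2.

Definition star_bisector i (j : 'I_(Ups m i)) : E3 R :=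
  bisector (vtx S m t (nb j) - vtx S m t i) (vtx S m t (nb (ordS j)) - vtx S m t i).

(* If two directions of the star nearly coincide, the normal line through
   a point [p] of one triangle meets the other one at some [x2]; both points
   project to the same point of the surface, against injectivity. *)
Lemma star_bisector_separated i (j k : 'I_(Ups m i)) : j != k ->
  26%:R * gamma * K * tri_diam S t j <= 1 -> 26%:R * gamma * K * tri_diam S t k <= 1 ->
  (3%:R * gamma)^-1 < enorm (star_bisector j - star_bisector k).
Proof.
move=> jk smj smk; rewrite ltNge; apply/negP => close.
have fj := star_fat g0 hm j t01; have fk := star_fat g0 hm k t01.
move: close smj smk fj fk; rewrite /star_bisector.
have ak := vtx_surface hm (nb k) t01; have bk := vtx_surface hm (nb (ordS k)) t01.
have xi := vtx_surface hm i t01.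
have [iaj ibj abj] := star_tri_neq hm j; have [iak ibk abk] := star_tri_neq hm k.
have disj := hull_interior_disjoint hm t01 jk.
set x := vtx S m t in ak bk xi disj *.
set ej := x (nb j) - x i; set fj := x (nb (ordS j)) - x i.
set ek := x (nb k) - x i; set fk := x (nb (ordS k)) - x i.
set hj := tri_diam S t j; set hk := tri_diam S t k.
set mj := bisector ej fj; set mk := bisector ek fk.
move=> close smj smk Fj Fk.
have hj0 := fat_gt0 Fj; have hk0 := fat_gt0 Fk; have g2 := fat_ge2 g0 Fk.
have c0 := fat_cross_gt0 g0 Fk; set n := cross ek fk in c0.
(* One scale that suits the cone lemma in both triangles. *)
pose s := Num.min hj hk / (2%:R * (gamma + 1)).
have d0 : 0 < 2%:R * (gamma + 1) by rewrite mulr_gt0 // addr_gt0.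
have s0 : 0 < s by rewrite divr_gt0 // lt_min hj0.
have sj : s <= hj / (2%:R * (gamma + 1)) by rewrite ler_pM2r ?invr_gt0 // ge_min lexx.
have sk : s <= hk / (2%:R * (gamma + 1)) by rewrite ler_pM2r ?invr_gt0 // ge_min lexx orbT.
have s2h : 2%:R * s <= hk.
  have := sk; rewrite ler_pdivlMr // => ?; apply: le_trans (_ : s * (2%:R * (gamma + 1)) <= _) => //.
  by rewrite mulrC ler_pM2l //; lra.
have bis (e f : E3 R) : dotp (bisector e f) (cross e f) = 0.
  by rewrite /bisector dotpDl !dotpZl dotp_crossl dotp_crossr !mulr0 addr0.
pose q := s *: mj; pose p := x i + q.
have [u [v [u0 v0 uv qE]]] : exists u v, [/\ 0 < u, 0 < v, u + v < 1 & q = u *: ej + v *: fj].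
  apply: (fat_bisector_cone g0 Fj s0 sj); first by rewrite dotpZl bis mulr0.
  by rewrite subrr enorm0 divr_ge0 // ltW.
have pE : p = x i + u *: ej + v *: fj by rewrite /p qE addrA.
have Gp : Gammah S m t p.
  apply: (star_hull_Gammah hm (j := j)); apply/(hull3P x iaj ibj abj).
  by exists u, v; split => //; exact: ltW.
have [Gy [s1 py s1le] pyle] := projP hN hm t01 Gp.
set y := Defs.proj S t p in Gy py pyle.
set nv := nu S t y in py.
have nv1 : enorm nv = 1 by have [] := nu_normal t01 Gy.
have px : enorm (p - x i) <= 2%:R * s.
  rewrite /p addrC addKr enormZ gtr0_norm // mulrC ler_pM2r //; exact: bisector_le2 Fj.
have xy : enorm (x i - y) <= 2%:R * hk.
  apply: le_trans (enorm_triangle p _ _) _; rewrite enormB.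
  have := le_trans (pyle _ xi) px; move: px s2h; lra.
(* The distances to [y] are at most [3 hk] and [2 hk], and [9 + 4 = 13]. Doubled in
   [fat_transversal], this is the constant 26 in the smallness condition. *)
have near_plane (a : 'I_M) : Gamma S t (x a) -> enorm (x a - x i) <= hk ->
    `|dotp nv (x a - x i)| <= 13%:R * K * hk ^+ 2.
  move=> Ga ax; have -> : x a - x i = (x a - y) - (x i - y) by rewrite opprB addrA subrK.
  have ay : enorm (x a - y) <= 3%:R * hk.
    by apply: le_trans (enorm_triangle (x i) _ _) _; move: ax xy; lra.
  have sq (w : E3 R) c : 0 <= c -> enorm w <= c * hk -> K * enorm w ^+ 2 <= c ^+ 2 * K * hk ^+ 2.
    move=> c1 wc; rewrite mulrAC (mulrC _ K) -exprMn ler_pM2l //.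
    by rewrite ler_pXn2r // nnegrE ?enorm_ge0 // mulr_ge0 // ltW.
  rewrite dotpDr dotpNr; apply: le_trans (ler_normD _ _) _; rewrite normrN.
  rewrite ![dotp nv _]dotpC.
  have := le_trans (quad Gy Ga) (sq _ _ (ler0n _ 3) ay).
  have := le_trans (quad Gy xi) (sq _ _ (ler0n _ 2) xy); lra.
have trans : enorm n <= 2%:R * `|dotp nv n|.
  case: (Fk) => /andP[_ ekh] /andP[_ fkh] _ _ _.
  apply: (fat_transversal g0 Fk nv1 (near_plane _ ak ekh) (near_plane _ bk fkh)).
  rewrite (_ : _ * _ = 26%:R * gamma * K * hk * hk); last by ring.
  by rewrite ler_piMl // ltW.
have nn0 : dotp nv n != 0.
  by apply/eqP => z; move: trans; rewrite z normr0 mulr0 leNgt c0.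
pose D := enorm (mj - mk).
have Dg : 3%:R * D * gamma <= 1.
  rewrite mulrAC mulrC -ler_pdivlMr ?mulr_gt0 // div1r; exact: close.
have D0 : 0 <= D := enorm_ge0 _.
(* The shift along [nv] that brings [q] into the plane of triangle [k]. As [mk] lies in that plane,
   only [s (mj - mk)] contributes and [|s3| <= 2 s D]. With the shift [s D] from [s mk] to [q] this
   makes [3 s D <= s / gamma], whence the separation [1 / (3 gamma)]. *)
pose s3 := - (dotp q n / dotp nv n).
have s3le : `|s3| <= 2%:R * s * D.
  rewrite normrN normrM normfV ler_pdivrMr ?normr_gt0 //.
  have -> : dotp q n = dotp (s *: (mj - mk)) n.
    by rewrite /q !dotpZl dotpDl dotpNl (bis ek fk) subr0.
  apply: le_trans (dotp_le _ _) _; rewrite enormZ gtr0_norm // -/D.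
  apply: le_trans (ler_wpM2l _ trans) _; first by rewrite mulr_ge0 // ltW.
  by rewrite mulrA (mulrC _ 2%:R) mulrA.
pose q2 := q + s3 *: nv.
have q2n : dotp q2 n = 0.
  by rewrite /q2 dotpDl (dotpZl s3 nv) /s3 mulNr divfK // subrr.
have q2m : enorm (q2 - s *: mk) <= s / gamma.
  have -> : q2 - s *: mk = s *: (mj - mk) + s3 *: nv.
    by rewrite /q2 /q scalerBr addrAC.
  apply: le_trans (enormD _ _) _; rewrite !enormZ nv1 mulr1 (gtr0_norm s0) -/D.
  rewrite ler_pdivlMr //; apply: le_trans (_ : 3%:R * D * s * gamma <= _).
    by rewrite ler_pM2r //; move: s3le; lra.
  by rewrite mulrAC ler_piMl // ltW.
have [u2 [v2 [u20 v20 uv2 q2E]]] := fat_bisector_cone g0 Fk s0 sk q2n q2m.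
pose x2 := x i + q2.
have hx2 : hull x (star_tri k) x2.
  apply/(hull3P x iak ibk abk); exists u2, v2; rewrite /x2 q2E addrA.
  by split => //; exact: ltW.
have Gx2 := star_hull_Gammah hm hx2.
have x2y : x2 - y = (s1 + s3) *: nv.
  by rewrite /x2 /q2 addrA -/p {1}py scalerDl addrAC [y + _]addrC addrK.
have [Gy2 _ y2le] := projP hN hm t01 Gx2.
set y2 := Defs.proj S t x2 in Gy2 y2le.
have s13 : `|s1 + s3| <= 3%:R * s.
  apply: le_trans (ler_normD _ _) _.
  have l1 := le_trans (s1le _ xi) px.
  have D1 : 2%:R * D <= 1 by move: Dg D0 g2; nra.
  have : 2%:R * D * s <= s by rewrite ler_piMl // ltW.
  move: l1 s3le; lra.
have sK : 12%:R * (K * s) <= 1.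
  have : 26%:R * K * hk * 2%:R <= 1.
    apply: le_trans smk; rewrite [leRHS](_ : _ = 26%:R * K * hk * gamma); last by ring.
    by rewrite ler_pM2l // !mulr_gt0.
  have : K * (2%:R * s) <= K * hk by rewrite ler_pM2l.
  have : 0 < K * s by rewrite mulr_gt0.
  lra.
have E : y = y2.
  apply/esym/eqP; rewrite -subr_eq0; apply/eqP.
  apply: (normal_line_nearest nv1 s13 sK (quad Gy Gy2)).
  have -> : (s1 + s3) *: nv - (y2 - y) = x2 - y2 by rewrite -x2y opprB addrA subrK.
  rewrite -x2y; exact: y2le.
have := proj_inj hm t01 Gp Gx2 E => px2.
by apply: (disj u v u0 v0 uv); rewrite -/ej -/fj -pE px2.
Qed.

End TwoSheets.

(** The number of cells of side [1 / (9 gamma)] used to cover the cube [[-2, 2]^3]. Vectors in a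
    common cell differ by at most [3 / (9 gamma)], which is the separation of the bisectors. *)
Definition packing (R : realType) (gamma : R) : nat :=
  #|{ffun 'I_3 -> 'I_(Num.truncn (36%:R * gamma)).+1}|.

Lemma packing_bound (R : realType) (gamma : R) (I : finType) (J : {set I}) (v : I -> E3 R) :
  0 < gamma -> (forall j, j \in J -> enorm (v j) <= 2%:R) ->
  (forall j k, j \in J -> k \in J -> j != k ->
     (3%:R * gamma)^-1 < enorm (v j - v k)) ->
  (#|J| <= packing gamma)%N.
Proof.
move=> g0 v2 sep; have g9 : 0 < 9%:R * gamma by rewrite mulr_gt0.
pose c j k := (v j 0 k + 2%:R) * (9%:R * gamma).
have c0 j k : j \in J -> 0 <= c j k <= 36%:R * gamma.
  move=> /v2 vj; have := le_trans (enorm_coord (v j) k) vj; rewrite ler_norml => /andP[l1 l2].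
  rewrite /c mulr_ge0 ?(ltW g9) //=; last by lra.
  rewrite (_ : 36%:R * gamma = 4%:R * (9%:R * gamma)); last by ring.
  by rewrite ler_pM2r //; lra.
pose F j : {ffun 'I_3 -> 'I_(Num.truncn (36%:R * gamma)).+1} :=
  [ffun k => inord (Num.truncn (c j k))].
have Finj : {in J &, injective F}.
  move=> j k jJ kJ Fjk; apply/eqP/negPn/negP => jk.
  have := sep j k jJ kJ jk; apply/negP; rewrite -leNgt.
  have near l : `|(v j - v k) 0 l| <= (9%:R * gamma)^-1.
    have /(congr1 (fun f : {ffun _} => nat_of_ord (f l))) := Fjk.
    have /andP[cj0 cj1] := c0 j l jJ; have /andP[ck0 ck1] := c0 k l kJ.
    rewrite !ffunE !inordK ?ltnS ?le_truncn // => E.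
    have /andP[a1 a2] := truncn_itv cj0; have /andP[b1 b2] := truncn_itv ck0.
    rewrite -[_^-1]div1r ler_pdivlMr // -(gtr0_norm g9) -normrM !mxE.
    have -> : (v j 0 l - v k 0 l) * (9%:R * gamma) = c j l - c k l by rewrite /c; ring.
    rewrite ler_norml; move: a1 a2 b1 b2; rewrite E -natr1.
    by move=> *; apply/andP; split; lra.
  apply: le_trans (enorm_le_coord _) _.
  have := near 0; have := near 1; have := near 2%:R.
  have -> : (3%:R * gamma)^-1 = 3%:R * (9%:R * gamma)^-1 by field; rewrite gt_eqF.
  lra.
by rewrite -(card_in_imset Finj); exact: max_card.
Qed.

Lemma iter_ordS n (j : 'I_n) k : nat_of_ord (iter k (@ordS n) j) = ((j + k) %% n)%N.
Proof.
elim: k => [|k IH]; first by rewrite addn0 modn_small.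
by rewrite iterS /= IH -addn1 modnDml addn1 addnS.
Qed.

(* Walk from [j0] until leaving the small indices or meeting [j1]; the indices
   visited before are distinct and small, so there are at most [B] of them. *)
Lemma cyclic_ratio (R : realType) n (l : 'I_n -> R) (small : pred 'I_n) (G r D : R) B :
  1 <= G -> 0 < r -> 0 <= D -> (forall j, 0 < l j <= D) ->
  (forall j, l (ordS j) <= G * l j) -> (forall j, ~~ small j -> r <= G * l j) ->
  (#|[set j | small j]%SET| <= B)%N ->
  forall j0 j1, l j1 <= (1 + D / r) * G ^+ B.+1 * l j0.
Proof.
move=> G1 r0 D0 lD lS lsmall cB j0 j1.
pose J k := iter k (@ordS n) j0.
pose stop k := ~~ small (J k) || (J k == j1).
have [k stopk mink] : exists2 k, stop k & forall k', stop k' -> (k <= k')%N.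
  have ex : exists k, stop k.
    exists (n - j0 + j1)%N; apply/orP; right; apply/eqP/ord_inj.
    rewrite /J iter_ordS addnA subnKC; last exact/ltnW.
    by rewrite modnDl modn_small.
  by exists (ex_minn ex); case: ex_minnP.
have before a : (a < k)%N -> small (J a).
  move=> ak; apply/negPn/negP => ns.
  by have := mink a; rewrite /stop ns /= leqNgt ak => /(_ isT).
have kB : (k <= B)%N.
  (* A repetition would make the walk periodic, and [J k] would already occur at the earlier time
     [k - b + a]. *)
  have noteq a b : (a < b)%N -> (b < k)%N -> J a <> J b.
    move=> ab bk eqJ.
    have E : J k = J (k - b + a)%N.
      have : J (k - b + b)%N = J (k - b + a)%N by rewrite /J !iterD -/(J a) eqJ.
      by rewrite subnK // ltnW.
    have := mink (k - b + a)%N; rewrite /stop -E => /(_ stopk).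
    by rewrite leqNgt; case/negP; lia.
  have inj : injective (fun a : 'I_k => J a).
    move=> a b eqJ; apply/val_inj; case: (ltngtP a b) => // ab.
      by case: (noteq _ _ ab (ltn_ord b)).
    by case: (noteq _ _ ab (ltn_ord a)).
  rewrite -[k]card_ord -(card_imset _ inj); apply: leq_trans cB.
  by apply/subset_leq_card/fintype.subsetP => _ /imsetP[a _ ->]; rewrite inE before.
have G0 : 0 <= G by apply: le_trans G1.
have walk k' : l (J k') <= G ^+ k' * l j0.
  elim: k' => [|k' IH]; first by rewrite expr0 mul1r.
  by rewrite exprS -mulrA; apply: le_trans (lS _) _; exact: ler_wpM2l.
have lj0 : 0 <= l j0 by have /andP[/ltW] := lD j0.
have walkB : l (J k) <= G ^+ B * l j0.
  apply: le_trans (walk k) _; apply: ler_wpM2r => //; exact: ler_weXn2l.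
have GB0 : 0 <= G ^+ B * l j0 by rewrite mulr_ge0 // exprn_ge0.
have gG : G ^+ B * l j0 <= G ^+ B.+1 * l j0.
  by apply: ler_wpM2r => //; apply: ler_weXn2l.
have Dr : 0 <= D / r by rewrite divr_ge0 // ltW.
rewrite -mulrA mulrDl mul1r.
(* If the walk stopped at [j1], its own bound suffices. If it stopped at an index that is not small,
   then [r <= G ^ B.+1 * l j0], and [l j1 <= D] is compared with [r]; the extra power of [G] comes
   from [lsmall]. *)
case/orP: stopk => [/lsmall rk|/eqP eqk]; last first.
  rewrite -eqk; apply: le_trans walkB _; apply: (le_trans gG).
  by rewrite lerDl; apply: mulr_ge0 => //; exact: le_trans gG.
have le1 : r <= G ^+ B.+1 * l j0.
  by apply: le_trans rk _; rewrite exprS -mulrA ler_wpM2l.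
have /andP[_ lj1] := lD j1.
apply: le_trans (_ : D / r * (G ^+ B.+1 * l j0) <= _); last first.
  by rewrite lerDr; exact: le_trans gG.
apply: le_trans lj1 _; rewrite mulrAC ler_pdivlMr // ler_wpM2l //.
Qed.

Section StarRatio.
Variables (R : realType) (S : evolving_surface R) (gamma : R).
Hypothesis g0 : 0 < gamma.

Lemma star_ratio0 : exists2 Lam : R, 0 < Lam & forall Nbh M (m : mesh R M),
  surface_nbhd S Nbh -> admissible_mesh S m gamma Nbh ->
  forall i (j0 j1 : 'I_(Ups m i)), nb_len S 0 j1 <= Lam * nb_len S 0 j0.
Proof.
have z01 := Tend_ge0 S.
have [_ cG _ rG] := Gamma0_surface S.
have [K K0 hK] := surface_quadratic cG rG.
have [D D0 hD] : exists2 D : R, 0 < D & forall y, Gamma0 S y -> enorm y <= D.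
  apply: compact_uniform cG _ => x _.
  have lt1 : enorm x < enorm x + 1 by rewrite ltrDl.
  exists (enorm x + 1); exists [set w | enorm w <= enorm x + 1].
    exact: (@cvgr_le R _ (nbhs x) (nbhs_filter x) _ _ (@continuous_enorm R x) _ lt1).
  by move=> C y lC /= ly _; exact: le_trans lC.
(* [r] is the diameter below which triangles count as small. The inequality [2 <= gamma] is
   available only once a triangle is given, so [1 <= G] is imposed here. *)
pose G := Num.max 1 gamma; pose r := (26%:R * gamma * K)^-1.
have gK : 0 < 26%:R * gamma * K by rewrite !mulr_gt0.
have r0 : 0 < r by rewrite invr_gt0.
exists ((1 + (2%:R * D) / r) * G ^+ (packing gamma).+1).
  rewrite mulr_gt0 ?exprn_gt0 ?lt_max ?ltr01 // ltr_wpDr // divr_ge0 ?mulr_ge0 // ltW //.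
move=> Nbh M m hN hm i j0 j1.
have quad y z : Gamma S 0 y -> Gamma S 0 z ->
    `|dotp (z - y) (nu S 0 y)| <= K * enorm (z - y) ^+ 2.
  move=> Gy Gz; have [n1 nn _] := nu_normal z01 Gy.
  by rewrite gamma0E in Gy Gz nn; exact: hK.
have fat0 (j : 'I_(Ups m i)) := star_fat g0 hm j z01.
have hl (j : 'I_(Ups m i)) : nb_len S 0 (ordS j) <= tri_diam S 0 j.
  by have [_ /andP[_ +] _ _ _] := fat0 j.
have hl' (j : 'I_(Ups m i)) : tri_diam S 0 j <= G * nb_len S 0 j.
  have := fat_el g0 (fat0 j); have := fat_gt0 (fat0 j) => h0 le1.
  apply: le_trans (_ : gamma * nb_len S 0 j <= _); last first.
    by apply: ler_wpM2r; [exact: enorm_ge0 | rewrite le_max lexx orbT].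
  by apply: le_trans le1; rewrite ler_peMl ?ler1n // ltW.
apply: (@cyclic_ratio R (Ups m i) (fun j => nb_len S 0 j)
  (fun j => 26%:R * gamma * K * tri_diam S 0 j <= 1)) => //.
- by rewrite le_max lexx.
- by rewrite mulr_ge0 // ltW.
- move=> j; have [/andP[-> _] _ _ _ _] := fat0 j; rewrite /nb_len /edge_len.
  apply: le_trans (enormD _ _) _; rewrite enormN mulr_natl mulr2n.
  by apply: lerD; apply: hD; rewrite -gamma0E; exact: (vtx_surface hm _ z01).
- by move=> j; exact: le_trans (hl j) (hl' j).
- move=> j; rewrite -ltNge => lt1; apply: le_trans (hl' j).
  by rewrite /r -[_^-1]div1r ler_pdivrMr // mulrC ltW.
- apply: (@packing_bound R gamma _ _ (fun j => star_bisector S 0 j) g0) => [j _|j k].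
    exact: bisector_le2 (fat0 j).
  rewrite !inE => sj sk jk.
  exact: (star_bisector_separated g0 hN hm z01 K0 quad jk sj sk).
Qed.

Lemma star_ratio : exists2 Lam : R, 0 < Lam & forall Nbh M (m : mesh R M),
  surface_nbhd S Nbh -> admissible_mesh S m gamma Nbh ->
  forall t i (j0 j1 : 'I_(Ups m i)), 0 <= t <= Tend S ->
    nb_len S t j1 <= Lam * nb_len S t j0.
Proof.
have [Lam Lam0 hL] := star_ratio0; have [B B1 hB] := flow_bilipschitz S.
have B0 : 0 < B by apply: lt_le_trans B1.
exists (B * Lam * B); first by rewrite !mulr_gt0.
move=> Nbh M m hN hm t i j0 j1 t01.
have GX k : Gamma0 S (x0 m k) by have [[]] := hm.
have z01 := Tend_ge0 S.
have bil (j : 'I_(Ups m i)) : nb_len S t j <= B * nb_len S 0 j /\ nb_len S 0 j <= B * nb_len S t j.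
  have := hB _ _ t (GX (nb j)) (GX i) t01.
  by rewrite /nb_len /edge_len /vtx !(Phi_init (GX _)).
apply: le_trans (bil j1).1 _; rewrite -!mulrA ler_pM2l //.
apply: le_trans (hL _ _ _ hN hm _ j0 j1) _.
by rewrite ler_pM2l //; exact: (bil j0).2.
Qed.

End StarRatio.

(** * Monotonicity of the scheme *)

(** Grouped by triangles, all terms carry the same weight [r j], so one triangle can be treated at a
    time. There the neighbour coefficients [d A / h] are dominated by [eps / l]. The remaining
    factor of [w0] is at most [C2 (2 d A + 2 A D d)], which is at most [d] by the choice of [C2]. *)
Lemma stencil_nonneg (R : realType) n (r h l w g : 'I_n -> R) (d tau eps w0 A D C2 : R) :
  0 < d -> 0 <= tau -> 0 <= eps -> 0 <= A -> 0 <= w0 ->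
  (forall j, 0 <= r j) -> (forall j, 0 <= w j) -> (forall j, d <= l j) ->
  (forall j, l j <= h j) -> (forall j, l (ordS j) <= h j) ->
  (forall j, A * h j <= eps) -> eps <= A * D * d ->
  (forall j, tau <= C2 * l j) -> 0 <= C2 -> C2 * (2%:R * A * (1 + D)) <= 1 ->
  (forall j, g j <= A / h j * (w j + w (ordS j) + 2%:R * w0)) ->
  0 <= w0 - tau * (\sum_j d * r j / (\sum_j d * r j) * g j -
    eps / (\sum_j d * r j) * \sum_j (w j - w0) / l j * (r (ord_pred j) + r j)).
Proof.
move=> d0 tau0 eps0 A0 w00 r0 w_0 dl lh lSh Ah epsD tl C20 C2A gA.
set V := \sum_j d * r j.
(* With [0^-1 = 0], a vanishing volume leaves just [w0]. *)
have [V0|Vn] := eqVneq V 0.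
  rewrite V0 invr0 mulr0 mul0r big1 ?subrr ?mulr0 ?subr0 // => j _.
  by rewrite mulr0 mul0r.
have Vp : 0 < V by rewrite lt0r Vn sumr_ge0 // => j _; rewrite mulr_ge0 // ltW.
have l0 j : 0 < l j by apply: lt_le_trans (dl j).
have h0 j : 0 < h j by apply: lt_le_trans (lh j).
(* Cyclic summation by parts: each edge has two adjacent triangles, and each triangle of the star
   has two edges at the vertex. *)
have -> : \sum_j (w j - w0) / l j * (r (ord_pred j) + r j) =
    \sum_j r j * ((w j - w0) / l j + (w (ordS j) - w0) / l (ordS j)).
  transitivity (\sum_j r j * ((w j - w0) / l j) +
      \sum_j r j * ((w (ordS j) - w0) / l (ordS j))); last first.
    by rewrite -big_split; apply: eq_bigr => j _; rewrite /= mulrDr.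
  rewrite [X in _ + X](_ : _ = \sum_j r (ord_pred j) * ((w j - w0) / l j)); last first.
    rewrite [RHS](reindex_inj (@ordS_inj n)) /=.
    by apply: eq_bigr => j _; rewrite ordSK.
  by rewrite -big_split; apply: eq_bigr => j _; rewrite /= mulrDr addrC !(mulrC _ (r _)).
have -> : \sum_j d * r j / V * g j - eps / V *
    \sum_j r j * ((w j - w0) / l j + (w (ordS j) - w0) / l (ordS j)) =
  V^-1 * \sum_j r j * (d * g j - eps * ((w j - w0) / l j + (w (ordS j) - w0) / l (ordS j))).
  rewrite !mulr_sumr -sumrB; apply: eq_bigr => j _.
  by rewrite mulrBr mulrBr; congr (_ - _); ring.
have tdiv a : 0 < a -> tau <= C2 * a -> tau / a <= C2 by move=> a0; rewrite ler_pdivrMr.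
have termwise j : tau * (d * g j - eps * ((w j - w0) / l j + (w (ordS j) - w0) / l (ordS j)))
    <= d * w0.
  have dg : d * g j <= d * (A / h j * (w j + w (ordS j) + 2%:R * w0)) by rewrite ler_pM2l.
  have coef a : 0 < a -> a <= h j -> d * (A / h j) <= eps / a.
    move=> a0 ah; rewrite mulrA ler_pdivlMr // mulrAC ler_pdivrMr //.
    apply: ler_pM => //; [by rewrite mulr_ge0 // ltW | exact: ltW |].
    rewrite mulrC; apply: le_trans (Ah j); rewrite ler_wpM2l //.
    exact: le_trans (dl j) (lh j).
  have c1 : d * (A / h j) * w j <= eps / l j * w j by rewrite ler_wpM2r // coef.
  have c2 : d * (A / h j) * w (ordS j) <= eps / l (ordS j) * w (ordS j).
    by rewrite ler_wpM2r // coef.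
  have th : tau / h j <= C2.
    by apply: tdiv => //; apply: le_trans (tl j) _; rewrite ler_wpM2l.
  have t1 := tdiv _ (l0 j) (tl j); have t2 := tdiv _ (l0 (ordS j)) (tl (ordS j)).
  apply: le_trans (_ : tau * ((d * (A / h j) * 2%:R + eps / l j + eps / l (ordS j)) * w0) <= _).
    apply: ler_wpM2l => //; rewrite mulrA in dg.
    rewrite (_ : eps * _ = eps / l j * (w j - w0) + eps / l (ordS j) * (w (ordS j) - w0));
      last by ring.
    lra.
  rewrite mulrA; apply: ler_wpM2r => //.
  have e1 : eps * (tau / l j) <= eps * C2 by rewrite ler_wpM2l.
  have e2 : eps * (tau / l (ordS j)) <= eps * C2 by rewrite ler_wpM2l.
  have e3 : 2%:R * (d * A) * (tau / h j) <= 2%:R * (d * A) * C2.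
    by rewrite ler_wpM2l // !mulr_ge0 // ltW.
  have e4 : eps * C2 <= A * D * d * C2 by rewrite ler_wpM2r.
  have e5 : C2 * (2%:R * A * (1 + D)) * d <= d by rewrite ler_piMl // ltW.
  have -> : tau * (d * (A / h j) * 2%:R + eps / l j + eps / l (ordS j)) =
    2%:R * (d * A) * (tau / h j) + eps * (tau / l j) + eps * (tau / l (ordS j)) by ring.
  lra.
rewrite subr_ge0 mulrCA ler_pdivrMl // mulr_sumr.
rewrite /V mulr_suml; apply: ler_sum => j _.
rewrite mulrCA (_ : d * r j * w0 = r j * (d * w0)); last by ring.
exact: ler_wpM2l.
Qed.

(** * Size and area of the volume around a vertex *)

Section Volume.
Variables (R : realType) (S : evolving_surface R) (M : nat) (m : mesh R M).
Variables (gamma : R) (Nbh : R -> set (E3 R)).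
Hypothesis g0 : 0 < gamma.
Hypothesis hm : admissible_mesh S m gamma Nbh.
Variables (t : R) (i : 'I_M).
Hypothesis t01 : 0 <= t <= Tend S.
Implicit Types j : 'I_(Ups m i).

Lemma star_ind j : aff_independent (vtx S m t) [set i; nb j; nb (ordS j)]%SET.
Proof.
by have [[_ _ _ ind _] _ _ _] := hm; apply: ind => //; exact: star_tri_in hm _ _.
Qed.

Lemma nb_len_le_diam j : 0 < nb_len S t j <= tri_diam S t j.
Proof. by have [] := star_fat g0 hm j t01. Qed.

Lemma nb_len_le_diamS j : nb_len S t (ordS j) <= tri_diam S t j.
Proof. by have [_ /andP[_ +] _ _ _] := star_fat g0 hm j t01. Qed.

Lemma tri_diam_le_nb_len j : 2%:R * tri_diam S t j <= gamma * nb_len S t j.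
Proof. exact: fat_el g0 (star_fat g0 hm j t01). Qed.

Lemma contact_dist_bounds j :
  2%:R * tri_diam S t j <= 3%:R * gamma ^+ 2 * contact_dist S t j /\
  contact_dist S t j <= nb_len S t j.
Proof.
have [ia ib ab] := star_tri_neq hm j.
rewrite /contact_dist (contactE ia ib ab (@star_ind j)); split.
  exact: fat_incircle g0 (star_fat g0 hm j t01).
rewrite /nb_len /edge_len; set e := vtx S m t (nb j) - _.
set f := vtx S m t (nb (ordS j)) - _.
by rewrite ler_pdivrMr // lerBlDr; have := enormD e (f - e); rewrite addrC subrK (enormB f e); lra.
Qed.

Lemma has_inf_contact j : has_inf (range (@contact_dist R M S m t i)).
Proof.
split; first by exists (contact_dist S t j); exists j.
by exists 0 => _ [k _ <-]; exact: enorm_ge0.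
Qed.

Lemma vol_dist_le j : vol_dist S m t i <= nb_len S t j.
Proof.
apply: le_trans (contact_dist_bounds j).2; apply: ge_inf; last by exists j.
by have [] := has_inf_contact j.
Qed.

Lemma vol_dist_ge c j : (forall k : 'I_(Ups m i), c <= contact_dist S t k) -> c <= vol_dist S m t i.
Proof.
move=> hc; apply: lb_le_inf; first by exists (contact_dist S t j); exists j.
by move=> _ [k _ <-].
Qed.

Lemma tri_diam_le_max j : tri_diam S t j <= max_tri_diam S m t i.
Proof.
apply: ub_le_sup; last by exists j.
exists (\sum_(k < Ups m i) tri_diam S t k) => _ [k _ <-].
rewrite (bigD1 k) //= lerDl sumr_ge0 // => l _.
by have /andP[/ltW l0] := nb_len_le_diam l; exact: le_trans.
Qed.

(** For any two triangles of the star, the diameter of the first is bounded by its edge, that edge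
    by [Lam] times an edge of the second, that edge by the second diameter, and this one by the
    second contact distance through [fat_incircle]. The powers [gamma] and [gamma ^ 2] multiply; the
    minimum over the second triangle gives [vol_dist]. *)
Lemma max_tri_diam_le Lam j : 0 < Lam ->
  (forall j0 j1 : 'I_(Ups m i), nb_len S t j1 <= Lam * nb_len S t j0) ->
  max_tri_diam S m t i <= 3%:R * gamma ^+ 3 * Lam * vol_dist S m t i.
Proof.
move=> Lam0 ratio; apply: ge_sup; first by exists (tri_diam S t j); exists j.
move=> _ [j1 _ <-].
have c0 : 0 < 3%:R * gamma ^+ 3 * Lam by rewrite !mulr_gt0 // exprn_gt0.
rewrite -ler_pdivrMl //; apply: (vol_dist_ge j) => k; rewrite ler_pdivrMl //.
have h1 := tri_diam_le_nb_len j1; have h2 := ratio k j1.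
have /andP[l0 h3] := nb_len_le_diam k; have [h4 _] := contact_dist_bounds k.
have gL : 0 < gamma * Lam by rewrite mulr_gt0.
have h5 : gamma * nb_len S t j1 <= gamma * (Lam * tri_diam S t k).
  by rewrite ler_pM2l //; apply: le_trans h2 _; rewrite ler_pM2l.
have h6 : gamma * Lam * (2%:R * tri_diam S t k) <=
    gamma * Lam * (3%:R * gamma ^+ 2 * contact_dist S t k) by rewrite ler_pM2l.
have d0 : 0 < tri_diam S t k by exact: lt_le_trans h3.
have p0 : 0 < gamma * Lam * tri_diam S t k by rewrite mulr_gt0.
have -> : 3%:R * gamma ^+ 3 * Lam * contact_dist S t k =
  gamma * Lam * (3%:R * gamma ^+ 2 * contact_dist S t k) by ring.
lra.
Qed.

Lemma volE : 0 <= vol_dist S m t i ->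
  [/\ forall j : 'I_(Ups m i), vol_part S t j = vol_dist S m t i * hR S t j,
      forall j : 'I_(Ups m i), hL S t j = hR S t (ord_pred j)
    & vol S m t i = \sum_(j < Ups m i) vol_dist S m t i * hR S t j].
Proof.
move=> d0.
have part (j : 'I_(Ups m i)) : vol_part S t j = vol_dist S m t i * hR S t j.
  have [ia ib ab] := star_tri_neq hm j.
  exact: (quad_areaE ia ib ab (@star_ind j) d0).
split => // [j|]; last by apply: eq_bigr => j _; exact: part.
have [ia ib ab] := star_tri_neq hm (ord_pred j).
have := corner_leg_eq ia ib ab (@star_ind (ord_pred j)) d0.
by rewrite /hL /hR /vol_foot /vol_corner ord_predK.
Qed.

End Volume.

Lemma cards3P (T : finType) (A : {set T}) : #|A| = 3%N ->
  exists i a b, [/\ i != a, i != b, a != b & A = [set i; a; b]%SET].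
Proof.
move=> A3; have /card_gt0P[i iA] : (0 < #|A|)%N by rewrite A3.
have /cards2P[a [b [ab E]]] : #|(A :\ i)%SET| == 2%N.
  by rewrite -(eqn_add2l (i \in A)) -cardsD1 A3 iA.
have iD : i \notin (A :\ i)%SET by rewrite !inE eqxx.
exists i, a, b; move: iD; rewrite E !inE negb_or => /andP[-> ->]; split => //.
by rewrite -(finset.setD1K iA) E finset.setUA.
Qed.

Section Monotone.
Variables (R : realType) (S : evolving_surface R) (M : nat) (m : mesh R M).
Variables (gamma : R) (Nbh : R -> set (E3 R)).
Hypothesis g0 : 0 < gamma.
Hypothesis hm : admissible_mesh S m gamma Nbh.

Lemma vtx_Gammah t i : Gammah S m t (vtx S m t i).
Proof.
have [[_ _ /(_ i)[K Kt iK] _ _] _ _ _] := hm.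
by exists K => //; exact: hull_vertex.
Qed.

(** On a triangle the values are convex combinations of nodal ones. Applied to the basis functions
    at the new time, it reduces the theorem to a comparison of coefficients. *)
Lemma in_Vh_ge0 t u : in_Vh S m t u -> (forall i, 0 <= u (vtx S m t i)) ->
  forall y, Gammah S m t y -> 0 <= u y.
Proof.
move=> [_ uV] u0 y [K Kt]; have [[_ c3 _ _ _] _ _ _] := hm.
have [i [a [b [ia ib ab E]]]] := cards3P (c3 _ Kt).
move=> hy; rewrite E in hy Kt; move/(hull3P _ ia ib ab): hy => [s [r [s0 r0 sr ->]]].
rewrite (affine_hull3 ia ib ab (fun y z s => uV _ y z s Kt)) //.
have -> : u (vtx S m t i) + s * (u (vtx S m t a) - u (vtx S m t i)) +
    r * (u (vtx S m t b) - u (vtx S m t i)) =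
  (1 - s - r) * u (vtx S m t i) + s * u (vtx S m t a) + r * u (vtx S m t b) by ring.
by rewrite !addr_ge0 ?mulr_ge0 //; lra.
Qed.

Lemma Ups_gt0 i : (0 < Ups m i)%N.
Proof.
have [[_ _ /(_ i)[K Kt iK] _ _] _ _ _] := hm.
by apply/card_gt0P; exists K; rewrite inE Kt.
Qed.

Variables (L2 Lam : R).
Hypotheses (L20 : 0 < L2) (Lam0 : 0 < Lam).
Variables (H : E3 R -> R -> E3 R -> R) (t tau eps : R) (i : 'I_M).
Hypothesis t01 : 0 <= t <= Tend S.
Hypothesis HL : forall p q,
  `|H (vtx S m t i) t p - H (vtx S m t i) t q| <= L2 * enorm (p - q).
Hypothesis ratio : forall j0 j1 : 'I_(Ups m i), nb_len S t j1 <= Lam * nb_len S t j0.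
Let A := L2 * gamma / 2%:R.
Let D := 3%:R * gamma ^+ 3 * Lam.

Lemma hamiltonian_diff u v w (j : 'I_(Ups m i)) :
  in_Vh S m t u -> in_Vh S m t v ->
  (forall y, Gammah S m t y -> u y <= v y) ->
  (forall k, w k = v (vtx S m t k) - u (vtx S m t k)) ->
  H (vtx S m t i) t (tgrad (vtx S m t) v i (star_tri j)) -
  H (vtx S m t i) t (tgrad (vtx S m t) u i (star_tri j)) <=
  A / tri_diam S t j * (w (nb j) + w (nb (ordS j)) + 2%:R * w i).
Proof.
move=> [_ uV] [_ vV] uv wE.
have w0 k : 0 <= w k by rewrite wE subr_ge0; apply: uv; exact: vtx_Gammah.
have [ia ib ab] := star_tri_neq hm j.
have Kt := star_tri_in hm j; have ind := star_ind hm t01 (j := j).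
have [un ue uf] := tgradP ia ib ab ind (fun y z s => uV _ y z s Kt).
have [vn ve vf] := tgradP ia ib ab ind (fun y z s => vV _ y z s Kt).
have F := star_fat g0 hm j t01; have h0 := fat_gt0 F.
apply: le_trans (ler_norm _) _; apply: le_trans (HL _ _) _.
rewrite -/(star_tri j) in un ue uf vn ve vf.
set gu := tgrad _ u _ _ in un ue uf *; set gv := tgrad _ v _ _ in vn ve vf *.
have /(fat_plane g0 F) : dotp (gv - gu) (cross (vtx S m t (nb j) - vtx S m t i)
    (vtx S m t (nb (ordS j)) - vtx S m t i)) = 0.
  by rewrite dotpDl dotpNl un vn subrr.
rewrite !(dotpDl gv) !(dotpNl gu) ue uf ve vf => le1.
have le2 a b : `|v (vtx S m t a) - v (vtx S m t b) -
    (u (vtx S m t a) - u (vtx S m t b))| <= w a + w b.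
  rewrite (_ : _ - _ = w a - w b); last by rewrite !wE; ring.
  by apply: le_trans (ler_normD _ _) _; rewrite normrN !ger0_norm.
have le3 : 2%:R * tri_diam S t j * enorm (gv - gu) <=
    gamma * (w (nb j) + w (nb (ordS j)) + 2%:R * w i).
  apply: le_trans le1 _; rewrite ler_pM2l //.
  have := le2 (nb j) i; have := le2 (nb (ordS j)) i; lra.
rewrite -(ler_pM2l h0).
have -> : tri_diam S t j * (A / tri_diam S t j * (w (nb j) + w (nb (ordS j)) + 2%:R * w i))
    = L2 / 2%:R * (gamma * (w (nb j) + w (nb (ordS j)) + 2%:R * w i)).
  by rewrite /A; field; rewrite gt_eqF.
have -> : tri_diam S t j * (L2 * enorm (gv - gu)) =
  L2 / 2%:R * (2%:R * tri_diam S t j * enorm (gv - gu)) by field.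
by rewrite ler_wpM2l // divr_ge0 // ltW.
Qed.

Lemma scheme_coef_le u v : 0 <= tau ->
  tau <= (2%:R * A * (1 + D))^-1 * min_nb_len S m t ->
  A * max_tri_diam S m t i <= eps <= A * max_tri_diam S m t i ->
  in_Vh S m t u -> in_Vh S m t v -> (forall y, Gammah S m t y -> u y <= v y) ->
  scheme_coef S m H t tau eps u i <= scheme_coef S m H t tau eps v i.
Proof.
move=> tau0 tauC /andP[epsl epsu] uV vV uv.
have A0 : 0 < A by rewrite divr_gt0 ?mulr_gt0.
have D0 : 0 < D by rewrite !mulr_gt0 ?exprn_gt0.
pose j0 : 'I_(Ups m i) := Ordinal (Ups_gt0 i).
have hd := max_tri_diam_le g0 hm t01 j0 Lam0 ratio.
have /andP[l0 lh0] := nb_len_le_diam g0 hm t01 j0.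
have mx0 : 0 < max_tri_diam S m t i.
  apply: lt_le_trans (tri_diam_le_max g0 hm t01 j0); exact: lt_le_trans lh0.
(* Positivity of this infimum is read off from the positive maximal diameter and its bound by
   [D * vol_dist]. *)
have d0 : 0 < vol_dist S m t i by rewrite -(pmulr_rgt0 _ D0); exact: lt_le_trans hd.
have [partE hLE volE'] := volE hm t01 (i := i) (ltW d0).
have C20 : 0 < (2%:R * A * (1 + D))^-1 by rewrite invr_gt0 !mulr_gt0 // addr_gt0.
pose w k := v (vtx S m t k) - u (vtx S m t k).
have w0 k : 0 <= w k by rewrite subr_ge0; apply: uv; exact: vtx_Gammah.
rewrite -subr_ge0.
have := @stencil_nonneg R (Ups m i) (fun j => hR S t j) (fun j => tri_diam S t j)
  (fun j => nb_len S t j) (fun j => w (nb j))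
  (fun j => H (vtx S m t i) t (tgrad (vtx S m t) v i (star_tri j)) -
     H (vtx S m t i) t (tgrad (vtx S m t) u i (star_tri j)))
  (vol_dist S m t i) tau eps (w i) A D (2%:R * A * (1 + D))^-1.
rewrite -volE' => stencil.
apply: le_trans (stencil _ _ _ _ _ _ _ _ _ _ _ _ _ _ _ _) _ => //.
- by apply: le_trans epsl; rewrite mulr_ge0 // ltW.
- exact: ltW.
- by move=> j; exact: enorm_ge0.
- by move=> j; exact: (vol_dist_le g0 hm t01 j).
- by move=> j; have /andP[] := nb_len_le_diam g0 hm t01 j.
- by move=> j; exact: (nb_len_le_diamS g0 hm t01 j).
- move=> j; apply: le_trans epsl; rewrite ler_pM2l //.
  exact: (tri_diam_le_max g0 hm t01 j).
- by apply: le_trans epsu _; rewrite -mulrA ler_pM2l.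
- move=> j; apply: le_trans tauC _; rewrite ler_pM2l //.
  apply: ge_inf; last by exists i, j.
  by exists 0 => _ [i' [j' ->]]; exact: enorm_ge0.
- exact: ltW.
- by rewrite mulVf // -invr_eq0 gt_eqF.
- by move=> j; exact: hamiltonian_diff.
(* What remains is an identity: the stencil expression is the difference of the two scheme
   values. *)
rewrite le_eqVlt; apply/orP; left; apply/eqP; rewrite /scheme_coef.
pose Hs (z : E3 R -> R) (j : 'I_(Ups m i)) :=
  H (vtx S m t i) t (tgrad (vtx S m t) z i (star_tri j)).
pose ds (z : E3 R -> R) (j : 'I_(Ups m i)) :=
  (z (vtx S m t (nb j)) - z (vtx S m t i)) / nb_len S t j * (hL S t j + hR S t j).
have -> : \sum_j vol_dist S m t i * hR S t j / vol S m t i * (Hs v j - Hs u j) =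
    \sum_j vol_part S t j / vol S m t i * Hs v j -
    \sum_j vol_part S t j / vol S m t i * Hs u j.
  by rewrite -sumrB; apply: eq_bigr => j _; rewrite partE mulrBr.
have -> : \sum_(j < Ups m i) (w (nb j) - w i) / nb_len S t j *
    (hR S t (ord_pred j) + hR S t j) = \sum_j ds v j - \sum_j ds u j.
  rewrite -sumrB; apply: eq_bigr => j _; rewrite /ds hLE -mulrBl -mulrBl.
  by congr (_ / _ * _); rewrite /w; ring.
rewrite /w /ds /Hs; ring.
Qed.

End Monotone.

Lemma time_grid_bounds (R : realType) (T : R) N tk n : time_grid T N tk -> (n <= N)%N ->
  0 <= tk n <= T.
Proof.
move=> [t0 tN tS] nN.
have mono k l : (l <= N)%N -> (k <= l)%N -> tk k <= tk l.
  move=> lN; elim: l lN => [|l IH] lN; first by rewrite leqn0 => /eqP ->.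
  rewrite leq_eqVlt => /predU1P[->//|kl].
  by apply: le_trans (IH (ltnW lN) kl) _; apply/ltW/tS.
by rewrite -{1}t0 -tN !mono.
Qed.
Unset Implicit Arguments.

Theorem lemma4p1 (R : realType) (S : evolving_surface R) (gamma L2 : R)
    (gamma_gt0 : 0 < gamma) (L2_gt0 : 0 < L2) :
  exists C0 C1 C2 : R,
    [/\ 0 < C0, C0 <= C1 & 0 < C2] /\
    forall (H : E3 R -> R -> E3 R -> R) (L1 : R),
      0 < L1 -> hamiltonian S H L1 L2 ->
    forall (Nbh : R -> set (E3 R)), surface_nbhd S Nbh ->
    forall (hstar : R) (M : nat) (m : mesh R M),
      0 < mesh_size S m < hstar -> admissible_mesh S m gamma Nbh ->
    forall chi : 'I_M -> R -> E3 R -> R, nodal_basis S m chi ->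
    forall (N : nat) (tk : nat -> R), time_grid (Tend S) N tk ->
    forall eps : nat -> 'I_M -> R,
      (forall n i, (n < N)%N -> 0 < eps n i) ->
    forall n : nat, (n < N)%N ->
      (forall i, C0 * max_tri_diam S m (tk n) i <= eps n i
                 <= C1 * max_tri_diam S m (tk n) i) ->
      tk n.+1 - tk n <= C2 * min_nb_len S m (tk n) ->
    forall u v : E3 R -> R, in_Vh S m (tk n) u -> in_Vh S m (tk n) v ->
      (forall y, Gammah S m (tk n) y -> u y <= v y) ->
      forall y, Gammah S m (tk n.+1) y ->
        scheme S m chi H tk eps n u y <= scheme S m chi H tk eps n v y.
Proof.
have [Lam Lam0 ratio] := star_ratio S gamma_gt0.
pose A := L2 * gamma / 2%:R; pose D := 3%:R * gamma ^+ 3 * Lam.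
have A0 : 0 < A by rewrite divr_gt0 ?mulr_gt0.
have D0 : 0 < D by rewrite !mulr_gt0 ?exprn_gt0.
(* The lower bound on [eps] absorbs the neighbours. The upper one gives [eps <= A * D * d], which
   enters the coefficient of [w i] and thus fixes [C2]. [Lam], hence [D], depends only on [gamma]
   and the evolving surface. *)
exists A, A, (2%:R * A * (1 + D))^-1; split.
  by split => //; rewrite invr_gt0 !mulr_gt0 // addr_gt0.
move=> H L1 _ [_ HL] Nbh hN hstar M m _ hm chi nodal N tk grid eps _ n nN epsb taub u v uV vV uv y Gy.
have t01 := time_grid_bounds grid (ltnW nN).
have t01' := time_grid_bounds grid nN.
have tau0 : 0 <= tk n.+1 - tk n by have [_ _ /(_ n nN)/ltW] := grid; rewrite subr_ge0.
rewrite /scheme; apply: ler_sum => i _; apply: ler_wpM2r.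
  have [chiV chi1] := nodal i _ t01'.
  by apply: (in_Vh_ge0 hm chiV) => // k; rewrite chi1 ler0n.
apply: (scheme_coef_le gamma_gt0 hm L2_gt0 Lam0 t01 _ _ tau0 taub (epsb i) uV vV uv).
  move=> p q; apply: HL; split => //.
  exact: (vtx_surface hm i t01).
by move=> j0 j1; exact: (ratio _ _ _ hN hm).
Qed.
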